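(* (a) Let $k\ge 1$ be an integer, let $B\in\mathbb{R}^{n_u\times n_u}$, $M\in\mathbb{R}^{n_u\times n_\sigma}$, $H\in\mathbb{R}^{n_g\times n_u}$, $F\in\mathbb{R}^{n_u}$, $g\in\mathbb{R}^{n_g}$ and $\alpha\ge 0$, and assume that $\rho(B)<1$ and that $H(I-B)^{-1}M$ is injective. Then the semi-implicit $k$-step one-shot method with descent step $\tau$ (defined in the context) converges for all sufficiently small $\tau>0$ (i.e. there is $\tau_0>0$ such that it converges for every $0<\tau<\tau_0$). (b) In particular, there exist a constant $C>0$ and, for each integer $k\ge1$, a piecewise polynomial function $\mathcal{P}_k$ of degree at most $4k$ with $\mathcal{P}_k>0$ on $[0,1)$, where $C$ is independent of $k$ and both $C$ and $\mathcal{P}_k$ are independent of $B,M,H,F,g,\alpha$ and of the dimensions $n_u,n_\sigma,n_g$, such that for all data as in (a) with moreover $\|B\|<1$, the semi-implicit $k$-step one-shot method converges for every $\tau>0$ satisfying $$\left(\frac{\|H\|^2\|M\|^2}{(1-\|B\|)^2(1-\|B\|^k)^2}\,\mathcal{P}_k(\|B\|)+C\alpha\right)\tau<1.$$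
   Context: $\|\cdot\|$ is the Euclidean vector norm and the induced matrix norm, $A^*$ is the conjugate transpose (here the transpose), $\rho$ is the spectral radius. The semi-implicit $k$-step one-shot method with descent step $\tau>0$ produces $(\sigma^{n+1},u^{n+1},p^{n+1})$ from $(\sigma^n,u^n,p^n)$ as follows: $\sigma^{n+1}=\sigma^n-\tau M^*p^n-\tau\alpha\sigma^{n+1}$; set $u^{n+1}_0=u^n$, $p^{n+1}_0=p^n$; for $\ell=0,1,\dots,k-1$ set $u^{n+1}_{\ell+1}=Bu^{n+1}_\ell+M\sigma^{n+1}+F$ and $p^{n+1}_{\ell+1}=B^*p^{n+1}_\ell+H^*(Hu^{n+1}_\ell-g)$; finally $u^{n+1}:=u^{n+1}_k$, $p^{n+1}:=p^{n+1}_k$. For $\sigma\in\mathbb{R}^{n_\sigma}$, let $u(\sigma)$ be the unique solution of $u=Bu+M\sigma+F$ and $p(\sigma)$ the unique solution of $p=B^*p+H^*(Hu(\sigma)-g)$. Let $\sigma^{\mathrm{ex}}_\alpha$ be the (unique) minimizer over $\sigma\in\mathbb{R}^{n_\sigma}$ of $J(\sigma)=\frac12\|Hu(\sigma)-g\|^2+\frac{\alpha}{2}\|\sigma\|^2$. The method ''converges'' means: for every initial guess $(\sigma^0,u^0,p^0)$, the sequence $(\sigma^n,u^n,p^n)$ converges to $(\sigma^{\mathrm{ex}}_\alpha,u(\sigma^{\mathrm{ex}}_\alpha),p(\sigma^{\mathrm{ex}}_\alpha))$. ''Piecewise polynomial of degree at most $d$'' on $[0,1)$ means that $[0,1)$ can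 be divided into finitely many intervals on each of which the function is a polynomial of degree at most $d$. *)

(* Defs.v *)
From mathcomp Require Import all_boot all_order all_algebra.
From mathcomp Require Import complex.
From mathcomp Require Import all_classical all_reals all_analysis.

Set Implicit Arguments.
Unset Strict Implicit.
Unset Printing Implicit Defensive.

Import Order.TTheory GRing.Theory Num.Theory.
Import numFieldNormedType.Exports.
Local Open Scope classical_set_scope.
Local Open Scope ring_scope.

Definition enorm (R : realType) (n : nat) (x : 'cV[R]_n) : R :=
  Num.sqrt (\sum_(i < n) x i ord0 ^+ 2).

Definition opnorm (R : realType) (m n : nat) (A : 'M[R]_(m, n)) : R :=
  sup [set enorm (A *m x) | x in [set x : 'cV[R]_n | enorm x <= 1]].

(* The eigenvalues are the complex ones; for n = 0 there are none and the
   value is sup set0 = 0. *)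
Definition spectral_radius (R : realType) (n : nat) (B : 'M[R]_n) : R :=
  sup [set ComplexField.Normc.normc z | z in
        [set z : complex R | eigenvalue (map_mx (real_complex R) B) z]].

(* xget 0 S is an element of S when S is nonempty; the two equations below are
   uniquely solvable when spectral_radius B < 1. *)
Definition state (R : realType) (nu ns : nat)
    (B : 'M[R]_nu) (M : 'M[R]_(nu, ns)) (F : 'cV[R]_nu)
    (s : 'cV[R]_ns) : 'cV[R]_nu :=
  xget 0 [set u | u = B *m u + M *m s + F].

Definition adjoint_state (R : realType) (nu ns ng : nat)
    (B : 'M[R]_nu) (M : 'M[R]_(nu, ns)) (H : 'M[R]_(ng, nu))
    (F : 'cV[R]_nu) (g : 'cV[R]_ng) (s : 'cV[R]_ns) : 'cV[R]_nu :=
  xget 0 [set p | p = B^T *m p + H^T *m (H *m state B M F s - g)].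

Definition cost (R : realType) (nu ns ng : nat)
    (B : 'M[R]_nu) (M : 'M[R]_(nu, ns)) (H : 'M[R]_(ng, nu))
    (F : 'cV[R]_nu) (g : 'cV[R]_ng) (alpha : R) (s : 'cV[R]_ns) : R :=
  1 / 2 * enorm (H *m state B M F s - g) ^+ 2 + alpha / 2 * enorm s ^+ 2.

Definition minimizer (T : Type) (R : realType) (J : T -> R) (x : T) : Prop :=
  forall y, J x <= J y.

Definition inner_step (R : realType) (nu ns ng : nat)
    (B : 'M[R]_nu) (M : 'M[R]_(nu, ns)) (H : 'M[R]_(ng, nu))
    (F : 'cV[R]_nu) (g : 'cV[R]_ng) (s : 'cV[R]_ns)
    (up : 'cV[R]_nu * 'cV[R]_nu) : 'cV[R]_nu * 'cV[R]_nu :=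
  (B *m up.1 + M *m s + F, B^T *m up.2 + H^T *m (H *m up.1 - g)).

(* The descent step is kept as an implicit equation for sigma n.+1. For
   tau > 0 and alpha >= 0 it is uniquely solvable, so each initial guess
   (sigma 0, u 0, p 0) is the start of exactly one run. *)
Definition one_shot_run (R : realType) (nu ns ng k : nat)
    (B : 'M[R]_nu) (M : 'M[R]_(nu, ns)) (H : 'M[R]_(ng, nu))
    (F : 'cV[R]_nu) (g : 'cV[R]_ng) (alpha tau : R)
    (sigma : nat -> 'cV[R]_ns) (u p : nat -> 'cV[R]_nu) : Prop :=
  forall n,
    sigma n.+1 = sigma n - tau *: (M^T *m p n) - (tau * alpha) *: sigma n.+1
    /\ (u n.+1, p n.+1) =
       iter k (inner_step B M H F g (sigma n.+1)) (u n, p n).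

Definition one_shot_converges (R : realType) (nu ns ng k : nat)
    (B : 'M[R]_nu) (M : 'M[R]_(nu, ns)) (H : 'M[R]_(ng, nu))
    (F : 'cV[R]_nu) (g : 'cV[R]_ng) (alpha tau : R) : Prop :=
  exists2 s_ex : 'cV[R]_ns,
    unique (minimizer (cost B M H F g alpha)) s_ex &
    forall (sigma : nat -> 'cV[R]_ns) (u p : nat -> 'cV[R]_nu),
      one_shot_run k B M H F g alpha tau sigma u p ->
      [/\ sigma n @[n --> \oo] --> s_ex,
          u n @[n --> \oo] --> state B M F s_ex &
          p n @[n --> \oo] --> adjoint_state B M H F g s_ex].

Definition one_shot_admissible (R : realType) (nu ns ng : nat)
    (B : 'M[R]_nu) (M : 'M[R]_(nu, ns)) (H : 'M[R]_(ng, nu)) (alpha : R) :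
    Prop :=
  [/\ 0 <= alpha, spectral_radius B < 1 &
      injective (fun s : 'cV[R]_ns => H *m invmx (1%:M - B) *m M *m s)].

Definition piecewise_poly (R : realType) (d : nat) (f : R -> R) : Prop :=
  exists (m : nat) (I : 'I_m -> interval R),
    [/\ trivIset setT (fun i => [set` I i]),
        \bigcup_i [set` I i] = `[0, 1[%classic,
        forall i, [set` I i]° !=set0 &
        forall i, exists2 q : {poly R},
          (size q <= d.+1)%N & {in I i, forall x, f x = q.[x]}].

(* Main.v *)
Require Import Defs.
From mathcomp Require Import all_boot all_order all_algebra.
From mathcomp Require Import complex.
From mathcomp Require Import all_classical all_reals all_analysis.
From mathcomp Require Import ring lra.

Import Order.TTheory GRing.Theory Num.Theory.
Import numFieldNormedType.Exports.
Local Open Scope classical_set_scope.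
Local Open Scope ring_scope.

(* Subtracting the limit makes one step of the method a linear map of the
   errors (s, u, p), so it suffices that this map has no complex eigenvalue l
   with |l| >= 1. Put z = 1 / l, D = B^k, T_j = 1 + B + ... + B^(j-1) and
   v = (1 - z D)^-1 M s. Eliminating u and p from the eigenvector equations and
   pairing the remaining one with s gives, for g = 1 + tau alpha,
     (g l - 1) |s|^2 = - tau (<H T_k v', H T_k v> - (1 - z) <v', U v>),
   where v' = (1 - conj z D)^-1 M s and U is a real matrix.
   Writing v = v1 + i (Im z) v2 with v1 and v2 the images of s under real
   matrices, the first pairing has real part
     |H T_k v1|^2 - (Im z)^2 |H T_k v2|^2
   and imaginary part of order Im z. As |Im z| <= |Im (g l)| and
   |1 - z| <= |g l - 1|, for small tau the imaginary part of the equation forces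
   Im (g l) to be small relative to |g l - 1|, and then the real part forces
   g l - 1 to be nearly a negative real; as |g l| >= 1 this gives
   |g l - 1| >= 1.8, more than the right-hand side allows, unless g l = 1. In
   that case l = 1, and the equation says H (1 - B)^-1 M s = 0, so s = 0.
   The bound on tau involves B only through |T_k|, |D|, |U| and the norm of
   (1 - z D)^-1; the latter is at most 1 / (1 - |B|^k) if |B| < 1, and then the
   constants 8 k^2 can serve as P_k. *)

(** * Frobenius inner product and norm, and their relation to the operator norm *)

Section Frobenius.
Context {R : realType}.
Implicit Types m n p : nat.

Definition dotm {m n} (X Y : 'M[R]_(m, n)) : R := \tr (X^T *m Y).
(** On one column this is [enorm]; on two columns [a b] it is the Hermitian norm of a + i b, so one
    norm serves real and complex vectors. *)
Definition fnorm {m n} (X : 'M[R]_(m, n)) : R := Num.sqrt (dotm X X).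

Lemma dotmE {m n} (X Y : 'M[R]_(m, n)) :
  dotm X Y = \sum_j \sum_i X i j * Y i j.
Proof.
rewrite /dotm /mxtrace; apply: eq_bigr => j _; rewrite mxE.
by apply: eq_bigr => i _; rewrite mxE.
Qed.

Lemma dotmC {m n} (X Y : 'M[R]_(m, n)) : dotm X Y = dotm Y X.
Proof. by rewrite /dotm -[LHS]mxtrace_tr trmx_mul trmxK. Qed.

Lemma dotmDr {m n} (X Y Z : 'M[R]_(m, n)) :
  dotm X (Y + Z) = dotm X Y + dotm X Z.
Proof. by rewrite /dotm mulmxDr raddfD. Qed.

Lemma dotmDl {m n} (X Y Z : 'M[R]_(m, n)) :
  dotm (X + Y) Z = dotm X Z + dotm Y Z.
Proof. by rewrite !(dotmC _ Z) dotmDr. Qed.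

Lemma dotmNr {m n} (X Y : 'M[R]_(m, n)) : dotm X (- Y) = - dotm X Y.
Proof. by rewrite /dotm mulmxN raddfN. Qed.

Lemma dotmNl {m n} (X Y : 'M[R]_(m, n)) : dotm (- X) Y = - dotm X Y.
Proof. by rewrite dotmC dotmNr dotmC. Qed.

Lemma dotmZr {m n} a (X Y : 'M[R]_(m, n)) : dotm X (a *: Y) = a * dotm X Y.
Proof. by rewrite /dotm -scalemxAr mxtraceZ. Qed.

Lemma dotmZl {m n} a (X Y : 'M[R]_(m, n)) : dotm (a *: X) Y = a * dotm X Y.
Proof. by rewrite dotmC dotmZr dotmC. Qed.

Lemma dotm_mull {m n p} (A : 'M[R]_(m, n)) (X : 'M[R]_(n, p)) Y :
  dotm (A *m X) Y = dotm X (A^T *m Y).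
Proof. by rewrite /dotm trmx_mul mulmxA. Qed.

Lemma dotm_mulr {m n p} (X : 'M[R]_(m, n)) (A : 'M[R]_(n, p)) Y :
  dotm (X *m A) Y = dotm X (Y *m A^T).
Proof. by rewrite /dotm trmx_mul -mulmxA mxtrace_mulC mulmxA. Qed.

Lemma dotm_ge0 {m n} (X : 'M[R]_(m, n)) : 0 <= dotm X X.
Proof.
rewrite dotmE; apply: sumr_ge0 => j _; apply: sumr_ge0 => i _.
by rewrite -expr2 sqr_ge0.
Qed.

Lemma sqr_entry_le {m n} (X : 'M[R]_(m, n)) i j : X i j ^+ 2 <= dotm X X.
Proof.
rewrite dotmE (bigD1 j) //= (bigD1 i) //= -addrA expr2 lerDl addr_ge0 //.
  by apply: sumr_ge0 => i' _; rewrite -expr2 sqr_ge0.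
apply: sumr_ge0 => j' _; apply: sumr_ge0 => i' _.
by rewrite -expr2 sqr_ge0.
Qed.

Lemma dotm_eq0 {m n} (X : 'M[R]_(m, n)) : dotm X X = 0 -> X = 0.
Proof.
move=> X0; apply/matrixP => i j; rewrite mxE; apply/eqP.
by rewrite -sqrf_eq0 eq_le sqr_ge0 andbT -X0 sqr_entry_le.
Qed.

Lemma dotm_CS {m n} (X Y : 'M[R]_(m, n)) :
  dotm X Y ^+ 2 <= dotm X X * dotm Y Y.
Proof.
have := dotm_ge0 (dotm Y Y *: X - dotm X Y *: Y).
rewrite !(dotmDl, dotmDr, dotmNl, dotmNr, dotmZl, dotmZr) (dotmC Y X).
have := dotm_ge0 Y; rewrite le_eqVlt => /orP[/eqP Y0 _|Y0].
  by rewrite (dotm_eq0 Y (esym Y0)) -(scale0r 0) !dotmZr !mul0r expr0n mulr0.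
set a := dotm X X; set b := dotm X Y; set c := dotm Y Y.
(* The squared norm of <Y, Y> X - <X, Y> Y expands to this product. *)
move=> h; have : 0 <= c * (a * c - b ^+ 2).
  by apply: (le_trans h); rewrite le_eqVlt; apply/orP; left; apply/eqP; ring.
by rewrite pmulr_rge0 // subr_ge0.
Qed.

Lemma fnorm_ge0 {m n} (X : 'M[R]_(m, n)) : 0 <= fnorm X.
Proof. exact: sqrtr_ge0. Qed.

Lemma sqr_fnorm {m n} (X : 'M[R]_(m, n)) : fnorm X ^+ 2 = dotm X X.
Proof. by rewrite sqr_sqrtr // dotm_ge0. Qed.

Lemma fnorm0_eq0 {m n} (X : 'M[R]_(m, n)) : fnorm X = 0 -> X = 0.
Proof. by move=> X0; apply: dotm_eq0; rewrite -sqr_fnorm X0 expr0n. Qed.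

Lemma fnorm0 {m n} : fnorm (0 : 'M[R]_(m, n)) = 0.
Proof. by rewrite /fnorm /dotm mulmx0 mxtrace0 sqrtr0. Qed.

Lemma dotm_le {m n} (X Y : 'M[R]_(m, n)) : `|dotm X Y| <= fnorm X * fnorm Y.
Proof.
rewrite -(@ler_pXn2r _ 2) ?nnegrE ?mulr_ge0 ?fnorm_ge0 //.
by rewrite real_normK ?num_real // exprMn !sqr_fnorm dotm_CS.
Qed.

Lemma fnormD {m n} (X Y : 'M[R]_(m, n)) : fnorm (X + Y) <= fnorm X + fnorm Y.
Proof.
rewrite -(@ler_pXn2r _ 2) ?nnegrE ?addr_ge0 ?fnorm_ge0 //.
rewrite sqr_fnorm !(dotmDl, dotmDr) (dotmC Y X) -!sqr_fnorm.
have := le_trans (ler_norm _) (dotm_le X Y); nra.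
Qed.

Lemma fnormZ {m n} a (X : 'M[R]_(m, n)) : fnorm (a *: X) = `|a| * fnorm X.
Proof.
by rewrite /fnorm dotmZl dotmZr mulrA -expr2 sqrtrM ?sqr_ge0 // sqrtr_sqr.
Qed.

Lemma fnorm_sum {m n k} (E : nat -> 'M[R]_(m, n)) :
  fnorm (\sum_(j < k) E j) <= \sum_(j < k) fnorm (E j).
Proof.
elim: k => [|k IH]; first by rewrite !big_ord0 fnorm0.
by rewrite !big_ord_recr /= (le_trans (fnormD _ _)) // lerD2r.
Qed.

Lemma enormE {n} (x : 'cV[R]_n) : enorm x = fnorm x.
Proof. by rewrite /enorm /fnorm dotmE big_ord1. Qed.

(* Row-wise Cauchy-Schwarz. *)
Lemma fnormM {m n p} (A : 'M[R]_(m, n)) (X : 'M[R]_(n, p)) :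
  fnorm (A *m X) <= fnorm A * fnorm X.
Proof.
rewrite -(@ler_pXn2r _ 2) ?nnegrE ?mulr_ge0 ?fnorm_ge0 //.
rewrite exprMn !sqr_fnorm !dotmE [in leRHS]exchange_big /=.
rewrite mulr_sumr; apply: ler_sum => j _.
rewrite mulr_suml; apply: ler_sum => i _.
rewrite -expr2; have := dotm_CS (row i A)^T (col j X).
have -> : dotm (row i A)^T (col j X) = (A *m X) i j.
  by rewrite dotmE big_ord1 mxE; apply: eq_bigr => l _; rewrite !mxE.
congr (_ <= _ * _); rewrite dotmE big_ord1; apply: eq_bigr => l _;
  by rewrite !mxE.
Qed.

Lemma opnorm_ge0 {m n} (A : 'M[R]_(m, n)) : 0 <= opnorm A.
Proof.
apply: le_trans (_ : enorm (A *m 0) <= _).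
  exact: sqrtr_ge0.
(* The Frobenius norm of A bounds the set, so its [sup] is a true supremum. *)
apply: ub_le_sup.
  exists (fnorm A) => _ [x /= + <-]; rewrite !enormE => x1.
  by rewrite (le_trans (fnormM _ _)) // ler_piMr // fnorm_ge0.
by exists 0 => //=; rewrite enormE fnorm0 ler01.
Qed.

Lemma enorm_opnorm {m n} (A : 'M[R]_(m, n)) (x : 'cV_n) :
  fnorm (A *m x) <= opnorm A * fnorm x.
Proof.
have [x0|x0] := eqVneq (fnorm x) 0.
  by rewrite (fnorm0_eq0 x x0) mulmx0 !fnorm0 mulr0.
have xp : 0 < fnorm x by rewrite lt_neqAle eq_sym x0 fnorm_ge0.
rewrite -ler_pdivrMr // mulrC -[_^-1]ger0_norm ?invr_ge0 ?fnorm_ge0 //.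
rewrite -fnormZ scalemxAr -enormE; apply: ub_le_sup.
  exists (fnorm A) => _ [y /= + <-]; rewrite !enormE => y1.
  by rewrite (le_trans (fnormM _ _)) // ler_piMr // fnorm_ge0.
exists ((fnorm x)^-1 *: x) => //=.
by rewrite enormE fnormZ ger0_norm ?invr_ge0 ?fnorm_ge0 // mulVf.
Qed.

Lemma dotm_cols {m n} (X : 'M[R]_(m, n)) :
  dotm X X = \sum_j dotm (col j X) (col j X).
Proof.
rewrite dotmE; apply: eq_bigr => j _; rewrite dotmE big_ord1.
by apply: eq_bigr => i _; rewrite !mxE.
Qed.

(** Column by column: squared Frobenius norms add up over the columns. With two columns, this bounds
    a real matrix acting on complex vectors. *)
Lemma fnorm_opnorm {m n p} (A : 'M[R]_(m, n)) (X : 'M[R]_(n, p)) :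
  fnorm (A *m X) <= opnorm A * fnorm X.
Proof.
rewrite -(@ler_pXn2r _ 2) ?nnegrE ?mulr_ge0 ?fnorm_ge0 ?opnorm_ge0 //.
rewrite exprMn !sqr_fnorm !dotm_cols mulr_sumr; apply: ler_sum => j _.
rewrite -!sqr_fnorm -exprMn !colE -mulmxA ler_pXn2r ?nnegrE ?mulr_ge0 //.
- exact: enorm_opnorm.
- exact: fnorm_ge0.
- exact: opnorm_ge0.
- exact: fnorm_ge0.
Qed.

(** By Cauchy-Schwarz |A^T X|^2 = <A A^T X, X> <= |A| |A^T X| |X|; divide by |A^T X|. *)
Lemma fnorm_opnorm_tr {m n p} (A : 'M[R]_(m, n)) (X : 'M[R]_(m, p)) :
  fnorm (A^T *m X) <= opnorm A * fnorm X.
Proof.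
have [/eqP ->|x0] := boolP (fnorm (A^T *m X) == 0).
  by rewrite mulr_ge0 ?opnorm_ge0 ?fnorm_ge0.
have xp : 0 < fnorm (A^T *m X) by rewrite lt_neqAle eq_sym x0 fnorm_ge0.
rewrite -(ler_pM2l xp) -expr2 sqr_fnorm dotm_mull trmxK dotmC.
apply: le_trans (ler_norm _) (le_trans (dotm_le _ _) _).
rewrite mulrA ler_wpM2r ?fnorm_ge0 // mulrC.
exact: fnorm_opnorm.
Qed.

End Frobenius.

(** * Complex vectors as real two-column matrices *)

Section ComplexScaling.
Context {R : realType}.

(** Right multiplication sends [a b] to [-b a], which is multiplication of a + i b by i; it commutes
    with every real matrix acting on the left. *)
Definition imx : 'M[R]_2 :=
  \matrix_(i, j) (((i == 0) && (j == 1))%:R - ((i == 1) && (j == 0))%:R).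

(* A real matrix with two columns [a b] stands for the complex vector a + i b;
   [cxscale x y] is its multiplication by x + i y. *)
Definition cxscale (x y : R) {n} (X : 'M[R]_(n, 2)) : 'M[R]_(n, 2) :=
  x *: X + y *: (X *m imx).

Lemma tr_imx : imx^T = - imx.
Proof.
apply/matrixP => i j; rewrite !mxE opprB [(j == 0) && _]andbC.
by rewrite [(j == 1) && _]andbC.
Qed.

Lemma mul_imx : imx *m imx = - 1%:M.
Proof.
by apply/matrixP => -[[|[|i]] // ?] [[|[|j]] // ?];
  rewrite mxE !big_ord_recl big_ord0 !mxE /= !(mulr0, mul0r, mulr1, mul1r,
    subr0, sub0r, mulrN, mulNr, addr0, add0r, oppr0, mulr0n, mulr1n).
Qed.

Lemma imxK {n} (X : 'M[R]_(n, 2)) : X *m imx *m imx = - X.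
Proof. by rewrite -mulmxA mul_imx mulmxN mulmx1. Qed.

Lemma dotm_imxr {n} (X Y : 'M[R]_(n, 2)) :
  dotm X (Y *m imx) = - dotm (X *m imx) Y.
Proof. by rewrite dotm_mulr tr_imx mulmxN dotmNr opprK. Qed.

Lemma dotm_imx {n} (X : 'M[R]_(n, 2)) : dotm X (X *m imx) = 0.
Proof. have := dotm_imxr X X; rewrite [X in _ = - X]dotmC; lra. Qed.

Lemma dotm_imx2 {n} (X Y : 'M[R]_(n, 2)) :
  dotm (X *m imx) (Y *m imx) = dotm X Y.
Proof. by rewrite dotm_imxr imxK dotmNl opprK. Qed.

Lemma cxscaleM x y {m n} (A : 'M[R]_(m, n)) (X : 'M[R]_(n, 2)) :
  A *m cxscale x y X = cxscale x y (A *m X).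
Proof. by rewrite mulmxDr -!scalemxAr mulmxA. Qed.

Lemma cxscaleD x y {n} (X Y : 'M[R]_(n, 2)) :
  cxscale x y (X + Y) = cxscale x y X + cxscale x y Y.
Proof. by rewrite /cxscale mulmxDl !scalerDr addrACA. Qed.

Lemma cxscaleN x y {n} (X : 'M[R]_(n, 2)) : cxscale x y (- X) = - cxscale x y X.
Proof. by rewrite /cxscale mulNmx !scalerN opprD. Qed.

Lemma cxscale0 x y {n} : cxscale x y (0 : 'M[R]_(n, 2)) = 0.
Proof. by rewrite /cxscale mul0mx !scaler0 addr0. Qed.

Lemma cxscale_imx x y {n} (X : 'M[R]_(n, 2)) :
  cxscale x y X *m imx = cxscale x y (X *m imx).
Proof. by rewrite /cxscale mulmxDl -!scalemxAl. Qed.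

Lemma cxscale_cxscale x y x' y' {n} (X : 'M[R]_(n, 2)) :
  cxscale x y (cxscale x' y' X) = cxscale (x * x' - y * y') (x * y' + y * x') X.
Proof.
rewrite /cxscale mulmxDl -!scalemxAl imxK !scalerDr !scalerA.
set Y := X *m imx; apply/matrixP => i j; rewrite !mxE; ring.
Qed.

(** [dotm] is the real part of the Hermitian product, so the adjoint of a scalar is its
    conjugate. *)
Lemma dotm_cxscale x y {n} (X Y : 'M[R]_(n, 2)) :
  dotm (cxscale x (- y) X) Y = dotm X (cxscale x y Y).
Proof.
by rewrite !(dotmDl, dotmDr, dotmZl, dotmZr) dotm_imxr mulrN mulNr.
Qed.

Lemma fnorm_cxscale x y {n} (X : 'M[R]_(n, 2)) :
  fnorm (cxscale x y X) = Num.sqrt (x ^+ 2 + y ^+ 2) * fnorm X.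
Proof.
rewrite /fnorm -sqrtrM ?addr_ge0 ?sqr_ge0 //; congr Num.sqrt.
rewrite !(dotmDl, dotmDr, dotmZl, dotmZr) dotm_imx2 dotm_imxr.
rewrite (dotmC _ X) -[dotm X _]opprK; have := dotm_imx X; nra.
Qed.

Lemma fnorm_cxscale_le x y c {n} (X : 'M[R]_(n, 2)) : 0 <= c ->
  x ^+ 2 + y ^+ 2 <= c ^+ 2 -> fnorm (cxscale x y X) <= c * fnorm X.
Proof.
move=> c0 h; rewrite fnorm_cxscale ler_wpM2r ?fnorm_ge0 //.
by rewrite -(ger0_norm c0) -sqrtr_sqr ler_wsqrtr.
Qed.

End ComplexScaling.

(** * Solving with a complex parameter, and estimates on the eigenvalue *)

Section ScalarEstimates.
Context {R : realType}.

Lemma unitmx_ker0 {n} (A : 'M[R]_n) :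
  (forall x : 'cV[R]_n, A *m x = 0 -> x = 0) -> A \in unitmx.
Proof.
move=> A0; rewrite -unitmx_tr unitmxE unitfE; apply/det0P => -[v v0 vA].
have /A0 v'0 : A *m v^T = 0 by rewrite -[A]trmxK -trmx_mul vA trmx0.
by rewrite -[v]trmxK v'0 trmx0 eqxx in v0.
Qed.

(** For z = x + i y the product (1 - z D)(1 - conj z D) is the real matrix [N]. Inverting [N]
    therefore solves the equations for z and for conj z with the same w; the condition s^2 = y^2
    covers both signs. *)
Lemma cxscale_solve {n} (D : 'M[R]_n) (x y : R) (Y : 'M[R]_(n, 2)) :
  (forall s X, s ^+ 2 = y ^+ 2 -> X = cxscale x s (D *m X) -> X = 0) ->
  exists w : 'M[R]_(n, 2), forall s, s ^+ 2 = y ^+ 2 ->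
    let v := w - cxscale x (- s) (D *m w) in v - cxscale x s (D *m v) = Y.
Proof.
move=> ker0.
pose N := 1%:M - (2 * x) *: D + (x ^+ 2 + y ^+ 2) *: (D *m D).
have NE s (w : 'M[R]_(n, 2)) : s ^+ 2 = y ^+ 2 ->
    (w - cxscale x (- s) (D *m w)) -
      cxscale x s (D *m (w - cxscale x (- s) (D *m w))) = N *m w.
  move=> sy; rewrite mulmxBr cxscaleM cxscaleD cxscaleN cxscale_cxscale.
  rewrite /cxscale.
  rewrite /N !mulmxDl mulNmx mul1mx -!scalemxAl !mulmxA -sy.
  move: (D *m w) (D *m w *m imx) (D *m D *m w) (D *m D *m w *m imx).
  by move=> X1 X2 X3 X4; apply/matrixP => i j; rewrite !mxE; ring.
(* A real kernel vector of [N], doubled to two columns, is killed by the two factors in turn. *)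
have Nu : N \in unitmx.
  apply: unitmx_ker0 => z Nz.
  have w0 : N *m row_mx z z = 0 :> 'M[R]_(n, 1 + 1).
    by rewrite mul_mx_row Nz row_mx0.
  have v0 :
      row_mx z z - cxscale x (- y) (D *m row_mx z z) = 0 :> 'M[R]_(n, 1 + 1).
    apply: (ker0 y) => //; apply/eqP; rewrite -subr_eq0.
    by rewrite (NE y) // w0.
  have : row_mx z z = 0 :> 'M[R]_(n, 1 + 1).
    by apply: (ker0 (- y)); rewrite ?sqrrN //; apply/eqP; rewrite -subr_eq0 v0.
  by rewrite -[0]row_mx0 => /eq_row_mx[].
exists (invmx N *m Y) => s sy v; rewrite /v (NE s) // mulmxA mulmxV //.
by rewrite mul1mx.
Qed.

(** For l = lx + i ly this is |1 - 1 / l| <= |g l - 1|: the left side is |l - 1| / |l| <= |l - 1|,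
    and |g l - 1|^2 - |l - 1|^2 = (g - 1) ((g + 1) |l|^2 - 2 lx). *)
Lemma inv_shift_le (g lx ly : R) :
  let r2 := lx ^+ 2 + ly ^+ 2 in 1 <= g -> 1 <= r2 ->
  (1 - lx / r2) ^+ 2 + (- ly / r2) ^+ 2 <= (g * lx - 1) ^+ 2 + (g * ly) ^+ 2.
Proof.
move=> r2 g1 l1; have r2n0 : r2 != 0 by rewrite gt_eqF //; lra.
have -> : (1 - lx / r2) ^+ 2 + (- ly / r2) ^+ 2 = (r2 - 2 * lx + 1) / r2.
  by rewrite /r2; field.
have r2lx : 2 * lx <= r2 + 1.
  have := sqr_ge0 (lx - 1); have := sqr_ge0 ly; rewrite /r2; nra.
apply: (@le_trans _ _ (r2 - 2 * lx + 1)).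
  by rewrite ler_pdivrMr; nra.
have -> : (g * lx - 1) ^+ 2 + (g * ly) ^+ 2 = g ^+ 2 * r2 - 2 * (g * lx) + 1.
  by rewrite /r2; ring.
rewrite -subr_ge0.
have -> : g ^+ 2 * r2 - 2 * (g * lx) + 1 - (r2 - 2 * lx + 1) =
   (g - 1) * ((g + 1) * r2 - 2 * lx) by ring.
by apply: mulr_ge0; nra.
Qed.

Lemma shift_eq0 (g lx ly : R) : 1 <= g -> 1 <= lx ^+ 2 + ly ^+ 2 ->
  (g * lx - 1) ^+ 2 + (g * ly) ^+ 2 = 0 -> [/\ g * lx = 1, lx = 1 & ly = 0].
Proof.
move=> g1 l1 /eqP; rewrite paddr_eq0 ?sqr_ge0 // !sqrf_eq0 subr_eq0.
have g0 : 0 < g by lra.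
rewrite mulf_eq0 (gt_eqF g0) /= => /andP[/eqP glx /eqP ly0].
have lx0 : 0 < lx by rewrite -(pmulr_rgt0 _ g0) glx.
split=> //; move: l1; rewrite ly0; nra.
Qed.

Lemma sqr_sum_le1 (x y : R) : x ^+ 2 + y ^+ 2 <= 1 -> `|y| <= 1.
Proof.
move=> xy; rewrite -(@ler_pXn2r _ 2) ?nnegrE // real_normK ?num_real //.
by rewrite expr1n; have := sqr_ge0 x; lra.
Qed.

(* Here [a0 + i b0] is [g l - 1] for an eigenvalue [l] and [g = 1 + tau alpha];
   [0 <= om ^+ 2 + 2 * a0] says [1 <= |g l|]. *)
Lemma eigen_eq_scalar (tau q a2 b2 c e1 e2 y a0 b0 om : R) :
  0 < tau -> tau * q ^+ 2 <= 1 / 8 ->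
  0 <= a2 <= q ^+ 2 -> 0 <= b2 <= q ^+ 2 -> `|c| <= q ^+ 2 ->
  `|e1| <= q ^+ 2 * om -> `|e2| <= q ^+ 2 * om ->
  0 <= om -> om ^+ 2 = a0 ^+ 2 + b0 ^+ 2 ->
  `|y| <= `|b0| -> `|y| <= 1 -> 0 <= om ^+ 2 + 2 * a0 ->
  a0 = - tau * (a2 - y ^+ 2 * b2 - e1) ->
  b0 = tau * (- 2 * y * c - e2) ->
  om = 0.
Proof.
move=> tau0; set t := tau * q ^+ 2 => t8 /andP[a20 a2q] /andP[b20 b2q] cq.
move=> e1q e2q om0 omE yb y1 l1 a0E b0E.
have scale z w : `|z| <= w -> `|tau * z| <= tau * w.
  by move=> zw; rewrite normrM gtr0_norm // ler_pM2l.
have {}e1q : `|tau * e1| <= om / 8.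
  apply: le_trans (scale _ _ e1q) _; rewrite mulrA -/t; nra.
have {}e2q : `|tau * e2| <= om / 8.
  apply: le_trans (scale _ _ e2q) _; rewrite mulrA -/t; nra.
have {}cq : `|tau * c| <= 1 / 8 by apply: le_trans (scale _ _ cq) _.
have {}a2q : tau * a2 <= 1 / 8 by apply: le_trans t8; rewrite ler_pM2l.
have {}b2q : tau * b2 <= 1 / 8 by apply: le_trans t8; rewrite ler_pM2l.
have ta2 : 0 <= tau * a2 by rewrite mulr_ge0 // ltW.
have tb2 : 0 <= tau * b2 by rewrite mulr_ge0 // ltW.
(* The imaginary equation gives |b0| <= |b0| / 4 + om / 8. *)
have b0le : `|b0| <= om / 6.
  have : `|b0| <= 2 * (`|y| * `|tau * c|) + `|tau * e2|.
    have -> : b0 = - (2 * (y * (tau * c))) - tau * e2 by rewrite b0E; ring.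
    apply: le_trans (ler_normB _ _) _; rewrite normrN !normrM.
    by rewrite (ger0_norm (ler0n R 2)).
  have : `|y| * `|tau * c| <= `|b0| * (1 / 8) by rewrite ler_pM.
  lra.
have yy : y ^+ 2 <= om / 6.
  rewrite -real_normK ?num_real // expr2.
  have : `|y| * `|y| <= `|b0| * 1 by rewrite ler_pM.
  lra.
have {}e1q := ler_normlP _ _ e1q; case: e1q => e1a e1b.
have yb2 : y ^+ 2 * (tau * b2) <= om / 48.
  have : y ^+ 2 * (tau * b2) <= om / 6 * (1 / 8).
    by rewrite ler_pM // sqr_ge0.
  lra.
have yb0 : 0 <= y ^+ 2 * (tau * b2) by rewrite mulr_ge0 ?sqr_ge0.
have a0u : a0 <= om / 2.
  have -> : a0 = - (tau * a2) + y ^+ 2 * (tau * b2) + tau * e1.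
    by rewrite a0E; ring.
  lra.
have a0l : - (1 / 8) - om / 8 <= a0.
  have -> : a0 = - (tau * a2) + y ^+ 2 * (tau * b2) + tau * e1.
    by rewrite a0E; ring.
  lra.
have b2le : b0 ^+ 2 <= om ^+ 2 / 36.
  rewrite -real_normK ?num_real //.
  have : `|b0| ^+ 2 <= (om / 6) ^+ 2 by rewrite ler_pXn2r ?nnegrE // divr_ge0.
  have -> : (om / 6) ^+ 2 = om ^+ 2 / 36 by field.
  by [].
apply/eqP; rewrite eq_le om0 andbT leNgt; apply/negP => omp.
(* From b0^2 <= om^2 / 36, |a0| is at least 0.9 om, and a0 <= om / 2 rules out the positive sign.
   Then om^2 + 2 a0 >= 0 gives om >= 1.8, whereas [a0l] allows only 0.9 om <= 1 / 8 + om / 8. *)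
have a0n : a0 <= - (9 / 10 * om).
  rewrite leNgt; apply/negP => h; nra.
nra.
Qed.

End ScalarEstimates.

(** * Absence of eigenvalues outside the open unit disc *)

Section Eigenvectors.
Context {R : realType}.

Lemma fnorm_dotm_le {m n} (X : 'M[R]_(m, n)) c :
  0 <= c -> fnorm X <= c -> dotm X X <= c ^+ 2.
Proof.
by move=> c0 Xc; rewrite -sqr_fnorm ler_pXn2r ?nnegrE ?fnorm_ge0.
Qed.

(** The last three hypotheses are the eigenvector equations for l = lx + i ly, with the new s
    inserted in the other two. [K] bounds (1 - z D)^-1 uniformly on the closed unit disc, and q^2 is
    a common bound for all quadratic terms per unit of |s|^2. *)
Lemma no_unstable_eigenvector {nu ns ng : nat}
    (D T G U : 'M[R]_nu) (S : 'M[R]_nu)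
    (M : 'M[R]_(nu, ns)) (H : 'M[R]_(ng, nu))
    (K c d m r q tau g lx ly : R)
    (s : 'M[R]_(ns, 2)) (u p : 'M[R]_(nu, 2)) :
  (forall (X : 'M[R]_(nu, 2)) (x y : R), x ^+ 2 + y ^+ 2 <= 1 ->
     fnorm X <= K * fnorm (X - cxscale x y (D *m X))) ->
  (forall X : 'M[R]_(nu, 2), fnorm (H *m (T *m X)) <= c * fnorm X) ->
  (forall X : 'M[R]_(nu, 2), fnorm (D *m X) <= d * fnorm X) ->
  (forall X : 'M[R]_(ns, 2), fnorm (M *m X) <= m * fnorm X) ->
  (forall X : 'M[R]_(nu, 2), fnorm (U *m X) <= r * fnorm X) ->
  0 <= K -> 0 <= c -> 0 <= d -> 0 <= m -> 0 <= r -> 0 <= q ->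
  c * (K * m) <= q -> c * (d * (K ^+ 2 * m)) <= q ->
  r * (K * m) ^+ 2 <= q ^+ 2 ->
  0 < tau -> tau * q ^+ 2 <= 1 / 8 ->
  1 <= g -> 1 <= lx ^+ 2 + ly ^+ 2 ->
  D *m T = T *m D ->
  T^T *m H^T *m H *m T = S + U -> G *m T = S *m D + U ->
  (forall (t : 'M[R]_(ns, 2)) v,
     v - D *m v = M *m t -> H *m (T *m v) = 0 -> t = 0) ->
  g *: cxscale lx ly s = s - tau *: (M^T *m p) ->
  cxscale lx ly u = D *m u + T *m (M *m cxscale lx ly s) ->
  cxscale lx ly p = D^T *m p + G *m u + S *m (M *m cxscale lx ly s) ->
  [/\ s = 0, u = 0 & p = 0].
Proof.
move=> hK hc hd hm hr K0 c0 d0 m0 r0 q0 q1 q2 q3 tau0 tauq g1 l1 DT SE GE inj.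
move=> sE uE pE.
set r2 := lx ^+ 2 + ly ^+ 2 in l1.
have r2p : 0 < r2 by exact: lt_le_trans l1.
have r2n0 : r2 != 0 by rewrite gt_eqF.
(* x + i y = 1 / l lies in the closed unit disc, where [hK] applies. *)
pose x := lx / r2; pose y := - ly / r2.
have xyE : x ^+ 2 + y ^+ 2 = r2^-1 by rewrite /x /y /r2; field.
have xy1 : x ^+ 2 + y ^+ 2 <= 1 by rewrite xyE invf_le1.
have cK n (X : 'M[R]_(n, 2)) : cxscale x y (cxscale lx ly X) = X.
  rewrite cxscale_cxscale.
  have -> : x * lx - y * ly = 1 by rewrite /x /y /r2; field.
  have -> : x * ly + y * lx = 0 by rewrite /x /y /r2; field.
  by rewrite /cxscale scale1r scale0r addr0.
have ker0 (a b : R) (X : 'M[R]_(nu, 2)) : a ^+ 2 + b ^+ 2 <= 1 ->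
    X = cxscale a b (D *m X) -> X = 0.
  move=> ab XE; apply: fnorm0_eq0; apply/eqP; rewrite eq_le fnorm_ge0 andbT.
  by apply: le_trans (hK X _ _ ab) _; rewrite -XE subrr fnorm0 mulr0.
have solve Y : exists w : 'M[R]_(nu, 2), forall s, s ^+ 2 = y ^+ 2 ->
    let v := w - cxscale x (- s) (D *m w) in v - cxscale x s (D *m v) = Y.
  by apply: cxscale_solve => b X by2; apply: ker0; rewrite by2.
(* adjointness moves the resolvent of the transpose onto the other factor *)
have pair (X v Z q' : 'M[R]_(nu, 2)) : v - cxscale x (- y) (D *m v) = X ->
    Z - cxscale x y (D^T *m Z) = q' -> dotm X Z = dotm v q'.
  move=> <- <-; rewrite [LHS]dotmDl [RHS]dotmDr dotmNl dotmNr dotm_cxscale.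
  by rewrite -cxscaleM dotm_mull.
have {}uE : u = cxscale x y (D *m u) + T *m (M *m s).
  by rewrite -[LHS]cK uE cxscaleD -!cxscaleM cK.
have {}pE : p = cxscale x y (D^T *m p) + (cxscale x y (G *m u) + S *m (M *m s)).
  by rewrite -[LHS]cK pE !cxscaleD -!cxscaleM cK addrA.
have s0 : s = 0; last first.
  have u0 : u = 0.
    by apply: (ker0 x y) => //; rewrite [LHS]uE s0 !mulmx0 addr0.
  split=> //; apply: dotm_eq0.
  (* [hK] concerns D, not its transpose. So solve (1 - conj z D) X = p and pair p with itself:
     adjointness turns this into a pairing with 0. *)
  have [w /(_ (- y))] := solve p.
  rewrite sqrrN opprK => /(_ erefl) wE.
  rewrite (pair _ _ _ 0 wE).
    by rewrite /dotm mulmx0 mxtrace0.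
  by rewrite [X in X - _]pE u0 s0 !mulmx0 cxscale0 !addr0 subrr.
(* The same w gives v = (1 - conj z D) w and v' = (1 - z D) w, the solutions at z and at conj z,
   hence the common splitting v1 + i y v2 and v1 - i y v2. *)
have [w wE] := solve (M *m s).
pose v := w - cxscale x (- y) (D *m w).
pose v' := w - cxscale x y (D *m w).
pose v1 := w - x *: (D *m w); pose v2 := D *m w.
have vE : v = v1 + y *: (v2 *m imx).
  by rewrite /v /cxscale scaleNr opprB addrA addrAC.
have v'E : v' = v1 - y *: (v2 *m imx) by rewrite /v' /cxscale opprD addrA.
have vR : v - cxscale x y (D *m v) = M *m s by exact: wE.
have v'R : v' - cxscale x (- y) (D *m v') = M *m s.
  by have := wE (- y); rewrite sqrrN opprK; apply.
have v2w : fnorm v2 <= d * (K * fnorm v).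
  apply: le_trans (hd _) _; rewrite ler_wpM2l //.
  by apply: hK; rewrite sqrrN.
clearbody v v' v1 v2; clear w wE.
(* T commutes with D, so T v solves the same equation as u. *)
have uT : u = T *m v.
  apply/eqP; rewrite -subr_eq0; apply/eqP; apply: (ker0 x y) => //.
  rewrite mulmxBr cxscaleD cxscaleN.
  have -> : D *m (T *m v) = T *m (D *m v) by rewrite !mulmxA DT.
  have -> : T *m v = T *m cxscale x y (D *m v) + T *m (M *m s).
    by rewrite -vR mulmxBr addrC subrK.
  by rewrite -[in RHS]cxscaleM [u in LHS]uE opprD addrACA subrr addr0.
pose q' := cxscale x y (G *m u) + S *m (M *m s).
(* Insert M s = v - z D v and G T = S D + U: the terms in S D cancel, leaving S v + z U v, and S is
   replaced through [SE]. *)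
have q'E : q' = T^T *m (H^T *m (H *m (T *m v))) -
    U *m (v - cxscale x y v).
  rewrite /q' uT mulmxA GE mulmxDl -vR !mulmxBr cxscaleD.
  rewrite !mulmxA SE mulmxDl !cxscaleM !mulmxA.
  move: (S *m v) (U *m v) (cxscale _ _ _) (cxscale _ _ _) => a b e f.
  by apply/matrixP => i j; rewrite !mxE; ring.
have pq : p - cxscale x y (D^T *m p) = q'.
  by rewrite [X in X - _]pE -/q' addrC addKr.
have pqi : p *m imx - cxscale x y (D^T *m (p *m imx)) = q' *m imx.
  by rewrite -pq mulmxBl cxscale_imx mulmxA.
pose om := Num.sqrt ((g * lx - 1) ^+ 2 + (g * ly) ^+ 2).
have om2 : om ^+ 2 = (g * lx - 1) ^+ 2 + (g * ly) ^+ 2.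
  by rewrite sqr_sqrtr // addr_ge0 ?sqr_ge0.
have om0 : 0 <= om by exact: sqrtr_ge0.
have vb : fnorm v <= K * (m * fnorm s).
  by apply: le_trans (hK _ _ _ xy1) _; rewrite vR ler_wpM2l.
have v'b : fnorm v' <= K * (m * fnorm s).
  by apply: le_trans (hK v' x (- y) _) _; rewrite ?sqrrN // v'R ler_wpM2l.
have v1b : fnorm v1 <= K * (m * fnorm s).
  have -> : v1 = 2^-1 *: (v + v').
    rewrite vE v'E; move: (v2 *m imx) => X.
    by apply/matrixP => i j; rewrite !mxE; field.
  rewrite fnormZ ger0_norm ?invr_ge0 //; have := fnormD v v'; lra.
pose a := H *m (T *m v1); pose b := H *m (T *m v2).
have ab : fnorm a <= q * fnorm s.
  apply: le_trans (hc _) _; apply: le_trans (_ : c * (K * (m * fnorm s)) <= _).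
    by rewrite ler_wpM2l.
  by rewrite !mulrA -(mulrA c) ler_wpM2r ?fnorm_ge0.
have bb : fnorm b <= q * fnorm s.
  apply: le_trans (hc _) _.
  apply: le_trans (_ : c * (d * (K * (K * (m * fnorm s)))) <= _).
    rewrite ler_wpM2l //; apply: le_trans v2w _.
    by rewrite !ler_wpM2l.
  have -> : c * (d * (K * (K * (m * fnorm s)))) =
    c * (d * (K ^+ 2 * m)) * fnorm s by ring.
  by rewrite ler_wpM2r ?fnorm_ge0.
pose S2 := dotm s s.
have S2E : S2 = fnorm s ^+ 2 by rewrite sqr_fnorm.
(* Pairing the first equation with s gives its real part, pairing it with i s its imaginary part. *)
have reE : (g * lx - 1) * S2 = - tau * dotm (M *m s) p.
  have := congr1 (dotm s) sE.
  rewrite dotmZr [dotm s (cxscale _ _ _)]dotmDr !dotmZr dotm_imx.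
  rewrite dotmDr dotmNr dotmZr -dotm_mull -/S2; lra.
have imE : g * ly * S2 = tau * dotm (M *m s) (p *m imx).
  have := congr1 (dotm (s *m imx)) sE.
  rewrite dotmZr [dotm _ (cxscale _ _ _)]dotmDr !dotmZr dotm_imx2.
  rewrite dotmDr dotmNr dotmZr -dotm_mull mulmxA dotm_imxr -/S2.
  rewrite [dotm (s *m imx) s]dotmC dotm_imx; lra.
pose z := U *m (v - cxscale x y v).
pose e1 := dotm v' z; pose e2 := dotm v' (z *m imx).
have Hv : H *m (T *m v) = a + y *: (b *m imx).
  by rewrite /a /b vE !mulmxDr -!scalemxAr !mulmxA.
have Hv' : H *m (T *m v') = a - y *: (b *m imx).
  by rewrite /a /b v'E !mulmxBr -!scalemxAr !mulmxA.
have Hvi : H *m (T *m (v *m imx)) = a *m imx - y *: b.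
  by rewrite 2!mulmxA -(mulmxA H) Hv mulmxDl -scalemxAl imxK scalerN.
have Wre : dotm (M *m s) p = dotm a a - y ^+ 2 * dotm b b - e1.
  rewrite (pair _ _ _ _ v'R pq) q'E -/z dotmDr dotmNr -/e1; congr (_ - _).
  rewrite -!dotm_mull Hv Hv' !(dotmDl, dotmDr, dotmNl, dotmNr, dotmZl, dotmZr).
  rewrite dotm_imx2 (dotmC _ a); ring.
have Wim : dotm (M *m s) (p *m imx) = - 2 * y * dotm a b - e2.
  rewrite (pair _ _ _ _ v'R pqi) q'E -/z mulmxBl dotmDr dotmNr -/e2.
  congr (_ - _); rewrite -!mulmxA -!dotm_mull Hvi Hv'.
  rewrite !(dotmDl, dotmDr, dotmNl, dotmNr, dotmZl, dotmZr) dotm_imx2.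
  by rewrite dotm_imx [dotm (b *m imx) b]dotmC dotm_imx (dotmC b a); ring.
(* The factor 1 - z in front of U is at most [om] in modulus, so this error vanishes together with
   [om]. *)
have zb : fnorm z <= r * (om * (K * (m * fnorm s))).
  apply: le_trans (hr _) _; rewrite ler_wpM2l //.
  have -> : v - cxscale x y v = cxscale (1 - x) (- y) v.
    rewrite /cxscale; move: (v *m imx) => X.
    by apply/matrixP => i j; rewrite !mxE; ring.
  apply: (@le_trans _ _ (om * fnorm v)); last by rewrite ler_wpM2l.
  apply: fnorm_cxscale_le => //; rewrite om2 sqrrN.
  exact: inv_shift_le.
have qe n (X : 'M[R]_(n, 2)) (Y : 'M[R]_(n, 2)) :
    fnorm X <= K * (m * fnorm s) -> fnorm Y <= r * (om * (K * (m * fnorm s))) ->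
    `|dotm X Y| <= q ^+ 2 * om * S2.
  move=> hX hY; apply: le_trans (dotm_le _ _) _.
  apply: le_trans (ler_pM _ _ hX hY) _; rewrite ?fnorm_ge0 // S2E.
  have -> : K * (m * fnorm s) * (r * (om * (K * (m * fnorm s)))) =
    r * (K * m) ^+ 2 * (om * fnorm s ^+ 2) by ring.
  by rewrite -(mulrA (q ^+ 2)) ler_wpM2r // mulr_ge0 ?sqr_ge0.
have e1b : `|e1| <= q ^+ 2 * om * S2 by exact: qe.
have e2b : `|e2| <= q ^+ 2 * om * S2.
  by apply: qe => //; rewrite /fnorm dotm_imx2.
have qs0 : 0 <= q * fnorm s by rewrite mulr_ge0 ?fnorm_ge0.
have a2b : dotm a a <= q ^+ 2 * S2.
  by rewrite S2E -exprMn; apply: fnorm_dotm_le.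
have b2b : dotm b b <= q ^+ 2 * S2.
  by rewrite S2E -exprMn; apply: fnorm_dotm_le.
have cb : `|dotm a b| <= q ^+ 2 * S2.
  rewrite S2E -exprMn; apply: le_trans (dotm_le _ _) _.
  by rewrite expr2 ler_pM ?fnorm_ge0.
apply: dotm_eq0; rewrite -/S2; apply/eqP; apply/contraT => S20.
have S2p : 0 < S2 by rewrite lt_neqAle eq_sym S20 dotm_ge0.
have yly : `|y| <= `|g * ly|.
  rewrite /y !normrM normrN normfV (gtr0_norm r2p).
  rewrite (ger0_norm (le_trans ler01 g1)).
  rewrite mulrC ler_pM ?invr_ge0 ?(ltW r2p) //.
  by apply: le_trans g1; rewrite invf_le1.
have y1 : `|y| <= 1 by exact: sqr_sum_le1 xy1.
have om_eq0 : om = 0.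
  apply: (@eigen_eq_scalar R tau q (dotm a a / S2) (dotm b b / S2)
    (dotm a b / S2) (e1 / S2) (e2 / S2) y (g * lx - 1) (g * ly) om) => //.
  - by rewrite divr_ge0 ?dotm_ge0 //= ler_pdivrMr.
  - by rewrite divr_ge0 ?dotm_ge0 //= ler_pdivrMr.
  - by rewrite normrM normfV (gtr0_norm S2p) ler_pdivrMr.
  - by rewrite normrM normfV (gtr0_norm S2p) ler_pdivrMr.
  - by rewrite normrM normfV (gtr0_norm S2p) ler_pdivrMr.
  - rewrite om2.
    have -> : (g * lx - 1) ^+ 2 + (g * ly) ^+ 2 + 2 * (g * lx - 1) =
      g ^+ 2 * r2 - 1 by rewrite /r2; ring.
    by rewrite subr_ge0 mulr_ege1 // exprn_ege1.
  - apply: (mulIf S20); rewrite reE Wre; field; exact: S20.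
  - apply: (mulIf S20); rewrite imE Wim; field; exact: S20.
(* Only l = 1 remains; the real part then reads |H T v|^2 = 0, and [inj] gives s = 0. *)
have [glx lx1 ly0] : [/\ g * lx = 1, lx = 1 & ly = 0].
  by apply: shift_eq0; rewrite // -om2 om_eq0 expr0n.
have y0 : y = 0 by rewrite /y ly0 oppr0 mul0r.
have x1 : x = 1 by rewrite /x /r2 ly0 lx1; field.
have e10 : e1 = 0.
  by apply/eqP; rewrite -normr_eq0 eq_le normr_ge0 andbT; move: e1b;
     rewrite om_eq0 mulr0 mul0r.
have a0 : H *m (T *m v) = 0.
  rewrite Hv y0 scale0r addr0; apply: dotm_eq0.
  move: reE; rewrite Wre glx subrr mul0r e10 y0 expr0n /= mul0r !subr0.
  by move/esym/eqP; rewrite mulf_eq0 oppr_eq0 gt_eqF //= => /eqP.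
have s0 : s = 0.
  by apply: (inj s v) => //; rewrite -vR x1 y0 /cxscale scale1r scale0r addr0.
by move: S20; rewrite /S2 s0 /dotm mulmx0 mxtrace0 eqxx.
Qed.

End Eigenvectors.

(** * Matrix powers tend to zero when all eigenvalues lie in the open unit disc *)

Section Powers.
Context {R : realType}.
Local Notation C := (complex R).
Local Notation normc := ComplexField.Normc.normc.

Lemma cvg0P (a : nat -> R) : a n @[n --> \oo] --> (0 : R) <->
  (forall e, 0 < e -> exists N, forall n, (N <= n)%N -> `|a n| < e).
Proof.
split=> [/cvgr0Pnorm_lt h e /h [N _ hN]|h].
  by exists N => n Nn; exact: hN.
by apply/cvgr0Pnorm_lt => e /h [N hN]; exists N.
Qed.

Lemma cvg0_contraction (a z : nat -> R) (r : R) :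
  (forall n, 0 <= a n) -> 0 <= r < 1 ->
  (forall n, a n.+1 <= r * a n + z n) ->
  z n @[n --> \oo] --> (0 : R) -> a n @[n --> \oo] --> (0 : R).
Proof.
move=> a0 /andP[r0 r1] az /cvg0P zc; apply/cvg0P => e e0.
(* With this threshold e / 2 is the fixed point of the perturbed recursion: r e / 2 + e (1 - r) / 2
   = e / 2. *)
have [|N zN] := zc (e * (1 - r) / 2); first by rewrite !mulr_gt0 ?subr_gt0.
have step m : a (N + m)%N <= r ^+ m * a N + e / 2.
  elim: m => [|m IH]; first by rewrite addn0 expr0 mul1r lerDl divr_ge0 ?ltW.
  rewrite addnS; apply: le_trans (az _) _.
  have := ltW (zN (N + m)%N (leq_addr _ _)).
  have := ler_norm (z (N + m)%N); rewrite exprS -mulrA.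
  have := ler_wpM2l r0 IH; lra.
have /cvg0P h : r ^+ m @[m --> \oo] --> (0 : R).
  by apply: cvg_expr; rewrite ger0_norm.
have aN1 : 0 < a N + 1 by rewrite ltr_wpDl.
have [|N' rN'] := h (e / 2 / (a N + 1)); first by rewrite !divr_gt0.
exists (N + N')%N => n Nn; rewrite ger0_norm //.
have Nn' : (N <= n)%N by apply: leq_trans Nn; exact: leq_addr.
have := step (n - N)%N; rewrite subnKC // => /le_lt_trans; apply.
have : r ^+ (n - N) * (a N + 1) < e / 2.
  rewrite -ltr_pdivlMr //; apply: le_lt_trans (ler_norm _) (rN' _ _).
  by rewrite leq_subRL.
have := exprn_ge0 (n - N) r0; lra.
Qed.

Lemma normc_nonneg (z : C) : 0 <= normc z.
Proof. by case: z => a b; exact: sqrtr_ge0. Qed.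

Lemma normc_real (x : R) : normc (real_complex R x) = `|x|.
Proof. by rewrite /= expr0n addr0 sqrtr_sqr. Qed.

(** The factors are stripped one at a time. If Q is the product of the remaining ones and w_m = Q
    A^m x, then w_(m+1) = l w_m + (A - l) w_m, where the last term tends to 0 and |l| < 1. This
    replaces a Jordan form. *)
Lemma cvg0_prod_shift n (A : 'M[C]_n.+1) (rs : seq C) (x : 'cV[C]_n.+1) :
  {in rs, forall l, normc l < 1} ->
  (forall i, normc ((horner_mx A (\prod_(l <- rs) ('X - l%:P)) *m
     (A ^+ m *m x)) i 0) @[m --> \oo] --> (0 : R)) ->
  forall i, normc ((A ^+ m *m x) i 0) @[m --> \oo] --> (0 : R).
Proof.
elim: rs => [|l rs IH] rs1 h.
  move=> i; have := h i; rewrite big_nil rmorph1.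
  by under eq_cvg do rewrite mul1mx.
apply: IH => [k krs|i]; first by apply: rs1; rewrite inE krs orbT.
set Q := horner_mx A _; pose w m := Q *m (A ^+ m *m x).
have wS m : w m.+1 = A *m w m.
  have : Q *m horner_mx A 'X = horner_mx A 'X *m Q.
    by rewrite !mulmxE -!rmorphM mulrC.
  by rewrite horner_mx_X /w exprS -mulmxE !mulmxA => ->.
apply: (@cvg0_contraction _ (fun m => normc ((w m.+1 - l *: w m) i 0))
  (normc l)) => [m||m|].
- exact: normc_nonneg.
- by rewrite rs1 ?mem_head // normc_nonneg.
- rewrite -ComplexField.Normc.normcM.
  have -> : (Q *m (A ^+ m.+1 *m x)) i 0 = l * w m i 0 + (w m.+1 - l *: w m) i 0.
    rewrite -/(w m.+1); move: (w m.+1) (w m) => X Y.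
    by rewrite !mxE addrCA subrr addr0.
  exact: le_normcD.
- apply: cvg_trans (h i); apply: near_eq_cvg; near=> m; congr normc.
  rewrite big_cons rmorphM /= rmorphB /= horner_mx_X horner_mx_C.
  by rewrite -mulmxE -mulmxA -/Q -/(w m) mulmxBl mul_scalar_mx wS.
Unshelve. all: by end_near. Qed.

Lemma cvg0_powers n (A : 'M[R]_n) (x : 'cV[R]_n) i :
  (forall z, eigenvalue (map_mx (real_complex R) A) z -> normc z < 1) ->
  (A ^+ m *m x) i 0 @[m --> \oo] --> (0 : R).
Proof.
case: n A x i => [|n] A x i h; first by case: i.
set A' := map_mx _ A in h.
have [rs rsE] := closed_field_poly_normal (char_poly A').
have rs1 : {in rs, forall l, normc l < 1}.
  move=> l lrs; apply: h; rewrite eigenvalue_root_char rsE.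
  rewrite rootZ ?root_prod_XsubC // lead_coef_eq0.
  by rewrite monic_neq0 ?char_poly_monic.
have := @cvg0_prod_shift _ A' rs (map_mx (real_complex R) x) rs1.
have -> : \prod_(l <- rs) ('X - l%:P) = char_poly A'.
  by rewrite rsE (monicP (char_poly_monic _)) scale1r.
(* With all roots of the characteristic polynomial in the product, the hypothesis is about the zero
   matrix. *)
rewrite Cayley_Hamilton => hx.
apply: norm_cvg0.
have -> : (fun m => `|(A ^+ m *m x) i 0|) =
    fun m => normc ((A' ^+ m *m map_mx (real_complex R) x) i 0).
  apply/funext => m.
  by rewrite /A' -rmorphXn /= -map_mxM [in RHS]mxE normc_real.
apply: hx => j.
under eq_cvg do rewrite mul0mx mxE ComplexField.Normc.normc0.
exact: cvg_cst.
Qed.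

End Powers.

(** * Spectral radius and resolvent bounds *)

Section Spectrum.
Context {R : realType}.
Local Notation normc := ComplexField.Normc.normc.

Lemma normc_eigenvalue_le n (B : 'M[R]_n) z :
  eigenvalue (map_mx (real_complex R) B) z -> normc z <= spectral_radius B.
Proof.
move=> zB; apply: ub_le_sup; last by exists z.
have [rs rsE] :=
  closed_field_poly_normal (char_poly (map_mx (real_complex R) B)).
(* The sum of the moduli of the finitely many roots bounds the set, so [sup] is an upper bound. *)
exists (\sum_(l <- rs) normc l) => _ [l /= + <-].
rewrite eigenvalue_root_char rsE (monicP (char_poly_monic _)) scale1r.
rewrite root_prod_XsubC => lrs; rewrite (big_rem l lrs) /= lerDl.
by apply: sumr_ge0 => ? _; exact: normc_nonneg.
Qed.

Lemma cvg0_powers_cxscale n (A : 'M[R]_n) (x : 'cV[R]_n) i :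
  (forall (X : 'M[R]_(n, 2)) (lx ly : R), 1 <= lx ^+ 2 + ly ^+ 2 ->
     A *m X = cxscale lx ly X -> X = 0) ->
  (A ^+ m *m x) i 0 @[m --> \oo] --> (0 : R).
Proof.
move=> h; apply: cvg0_powers => z; rewrite ltNge => zA; apply/negP => z1.
(* Eigenvectors are row vectors here; the transpose has the same characteristic polynomial, and its
   eigenvector v is a right eigenvector of A. The columns of X are the real and imaginary parts of
   v. *)
have : eigenvalue (map_mx (real_complex R) A)^T z.
  move: zA; rewrite !eigenvalue_root_char /char_poly -[in X in _ -> X]det_tr.
  congr (root (\det _) _); apply/matrixP => k l; rewrite !mxE.
  by rewrite eq_sym.
case/eigenvalueP => v vE v0; case/negP: v0; apply/eqP.
pose X : 'M[R]_(n, 2) :=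
  \matrix_(k, j) if j == 0 then complex.Re (v 0 k) else complex.Im (v 0 k).
have X0 : X = 0.
  apply: (h X (complex.Re z) (complex.Im z)).
    case: z z1 {vE zA} => a b /= ab.
    rewrite -[leLHS]sqrtr1 in ab; move: ab; rewrite ler_psqrt ?nnegrE //.
    by rewrite addr_ge0 ?sqr_ge0.
  have vk k : \sum_l v 0 l * real_complex R (A k l) = z * v 0 k.
    have /rowP/(_ k) := vE; rewrite !mxE => <-.
    by apply: eq_bigr => l _; rewrite !mxE.
  have ReD (a b : complex R) :
    complex.Re (a + b) = complex.Re a + complex.Re b by case: a b => ? ? [].
  have ImD (a b : complex R) :
    complex.Im (a + b) = complex.Im a + complex.Im b by case: a b => ? ? [].
  apply/matrixP => k j; rewrite !mxE.
  transitivity (if j == 0 then complex.Re (z * v 0 k)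
                else complex.Im (z * v 0 k)).
    rewrite -vk; case: ifP => jE; rewrite (big_morph _ ReD erefl)
      || rewrite (big_morph _ ImD erefl).
      apply: eq_bigr => l _; rewrite mxE jE.
      by case: (v 0 l) => a b /=; rewrite mulr0 subr0 mulrC.
    apply: eq_bigr => l _; rewrite mxE jE.
    by case: (v 0 l) => a b /=; rewrite mulr0 add0r mulrC.
  rewrite big_ord_recl big_ord1 !mxE /=.
  case: j => [[|[|//]] hj] /=; case: (z) (v 0 k) => a b [e f] /=;
    rewrite !(mulr0, mulr1, mulr0n, mulr1n, subr0, sub0r, addr0, add0r);
    by rewrite ?mulrN1 ?mulrN // addrC.
apply/rowP => k; rewrite mxE.
have Xk j : X k j = 0 by rewrite X0 mxE.
have := Xk 0; have := Xk 1; rewrite !mxE /=.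
by case: (v 0 k) => a b /= -> ->.
Qed.

Lemma cvg0_sum (I : finType) (f : I -> nat -> R) :
  (forall i, f i m @[m --> \oo] --> (0 : R)) ->
  \sum_i f i m @[m --> \oo] --> (0 : R).
Proof.
move=> f0; elim: (index_enum I) => [|i r IH].
  by apply/cvg0P => e e0; exists 0%N => n _; rewrite big_nil normr0.
have h : f i m + \sum_(j <- r) f j m @[m --> \oo] --> (0 : R).
  by rewrite -[X in _ --> X](addr0 0); apply: cvgD.
apply: cvg_trans h.
by apply: near_eq_cvg; near=> m; rewrite big_cons.
Unshelve. all: by end_near. Qed.

Lemma small_power n (B : 'M[R]_n) : spectral_radius B < 1 ->
  exists m0, forall m, (m0 <= m)%N -> fnorm (B ^+ m) <= 1 / 2.
Proof.
move=> B1.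
have Bij i j : (B ^+ m) i j @[m --> \oo] --> (0 : R).
  have h : (B ^+ m *m delta_mx j 0 : 'cV[R]_n) i 0 @[m --> \oo] --> (0 : R).
    by apply: cvg0_powers => z /normc_eigenvalue_le /le_lt_trans; apply.
  by apply: cvg_trans h; apply: near_eq_cvg; near=> m; rewrite -colE mxE.
have : dotm (B ^+ m) (B ^+ m) @[m --> \oo] --> (0 : R).
  have h : \sum_j \sum_i (B ^+ m) i j * (B ^+ m) i j @[m --> \oo] --> (0 : R).
    apply: cvg0_sum => j; apply: cvg0_sum => i.
    by rewrite -[X in _ --> X](mulr0 0); apply: cvgM.
  by apply: cvg_trans h; apply: near_eq_cvg; near=> m; rewrite dotmE.
move=> /cvg0P /(_ (1 / 4)) [|m0 hm0]; first by lra.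
exists m0 => m /hm0; rewrite ger0_norm ?dotm_ge0 // -sqr_fnorm => h.
rewrite -(@ler_pXn2r _ 2) ?nnegrE ?fnorm_ge0 //; apply/ltW/(lt_le_trans h).
by lra.
Unshelve. all: by end_near. Qed.

(** Iterating X = (X - z D X) + z D X gives |X| <= K |X - z D X| + |D^m0 X| with K independent of z.
    For large m0 the last term is at most |X| / 2 and is absorbed, which doubles K. *)
Lemma resolvent_bound n k (B : 'M[R]_n) : (0 < k)%N -> spectral_radius B < 1 ->
  exists2 K : R, 0 <= K & forall (X : 'M[R]_(n, 2)) (x y : R),
    x ^+ 2 + y ^+ 2 <= 1 ->
    fnorm X <= K * fnorm (X - cxscale x y (B ^+ k *m X)).
Proof.
move=> k0 /small_power[m0 hm0]; set D := B ^+ k.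
have Dm0 : fnorm (D ^+ m0) <= 1 / 2.
  by rewrite -exprM; apply: hm0; rewrite leq_pmull.
have [K K0 hK] : exists2 K : R, 0 <= K & forall (X : 'M[R]_(n, 2)) (x y : R),
    x ^+ 2 + y ^+ 2 <= 1 -> fnorm X <= K * fnorm (X - cxscale x y (D *m X)) +
      fnorm (D ^+ m0 *m X).
  elim: m0 {hm0 Dm0} => [|m [K K0 hK]].
    by exists 0 => // X x y _; rewrite mul0r add0r mul1mx.
  exists (K + fnorm (D ^+ m)); first by rewrite addr_ge0 ?fnorm_ge0.
  move=> X x y xy; apply: le_trans (hK X x y xy) _.
  rewrite mulrDl -addrA lerD2l.
  have {1}-> : X = (X - cxscale x y (D *m X)) + cxscale x y (D *m X).
    by rewrite subrK.
  rewrite mulmxDr; apply: le_trans (fnormD _ _) _; apply: lerD.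
    exact: fnormM.
  rewrite cxscaleM mulmxA mulmxE -exprSr.
  have := fnorm_cxscale_le x y 1 (D ^+ m.+1 *m X) ler01.
  by rewrite expr1n mul1r; apply.
exists (2 * K) => [|X x y xy]; first by rewrite mulr_ge0.
have := hK X x y xy; have := fnormM (D ^+ m0) X; have := fnorm_ge0 X; nra.
Qed.

Lemma resolvent_bound_contraction n (D : 'M[R]_n) (d : R) :
  d < 1 -> (forall X : 'M[R]_(n, 2), fnorm (D *m X) <= d * fnorm X) ->
  forall (X : 'M[R]_(n, 2)) (x y : R), x ^+ 2 + y ^+ 2 <= 1 ->
    fnorm X <= (1 - d)^-1 * fnorm (X - cxscale x y (D *m X)).
Proof.
move=> d1 hD X x y xy; rewrite mulrC ler_pdivlMr ?subr_gt0 //.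
have -> : fnorm X = fnorm (X - cxscale x y (D *m X) + cxscale x y (D *m X)).
  by rewrite subrK.
have h := fnormD (X - cxscale x y (D *m X)) (cxscale x y (D *m X)).
have := fnorm_cxscale_le x y 1 (D *m X) ler01.
rewrite expr1n mul1r => /(_ xy) h2; have := hD X.
move: h; rewrite subrK; lra.
Qed.

End Spectrum.

(** * Geometric sums and their adjoint analogues *)

Section Sums.
Context {R : realType}.

Definition geo {n} (B : 'M[R]_n) k : 'M[R]_n := \sum_(j < k) B ^+ j.

(** The sum of (B^T)^(k-1-j) E_j over j < k, in the recursive form in which the adjoint iteration
    produces it. *)
Fixpoint adj_sum {n c} (B : 'M[R]_n) (E : nat -> 'M[R]_(n, c)) k :=
  if k is k'.+1 then B^T *m adj_sum B E k' + E k' else 0.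

Lemma geo0 {n} (B : 'M[R]_n) : geo B 0 = 0.
Proof. by rewrite /geo big_ord0. Qed.

Lemma geoS {n} (B : 'M[R]_n) k : geo B k.+1 = geo B k + B ^+ k.
Proof. by rewrite /geo big_ord_recr. Qed.

Lemma geoSl {n} (B : 'M[R]_n) k : geo B k.+1 = 1%:M + B *m geo B k.
Proof.
rewrite /geo big_ord_recl expr0 mulmx_sumr; congr (_ + _).
by apply: eq_bigr => j _; rewrite mulmxE -exprS.
Qed.

Lemma geo_comm {n} (B : 'M[R]_n) k j : B ^+ j *m geo B k = geo B k *m B ^+ j.
Proof.
rewrite /geo mulmx_sumr mulmx_suml; apply: eq_bigr => i _.
by rewrite mulmxE -!exprD addnC.
Qed.

Lemma geoD {n} (B : 'M[R]_n) j k : geo B (j + k) = geo B j + B ^+ j *m geo B k.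
Proof.
elim: k => [|k IH]; first by rewrite addn0 geo0 mulmx0 addr0.
by rewrite addnS !geoS IH mulmxDr mulmxE -exprD addrA.
Qed.

Lemma geo_telescope {n} (B : 'M[R]_n) k :
  (1%:M - B) *m geo B k = 1%:M - B ^+ k.
Proof.
have := subrX1 B k; rewrite -/(geo B k) => h.
by rewrite -opprB mulNmx mulmxE -h opprB.
Qed.

Lemma eq_adj_sum {n c} (B : 'M[R]_n) (E E' : nat -> 'M[R]_(n, c)) k :
  E =1 E' -> adj_sum B E k = adj_sum B E' k.
Proof. by move=> EE'; elim: k => //= k ->; rewrite EE'. Qed.

Lemma adj_sumD {n c} (B : 'M[R]_n) (E E' : nat -> 'M[R]_(n, c)) k :
  adj_sum B (fun j => E j + E' j) k = adj_sum B E k + adj_sum B E' k.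
Proof.
elim: k => [|k /= ->]; first by rewrite addr0.
by rewrite mulmxDr addrACA.
Qed.

Lemma adj_sumM {n c e} (B : 'M[R]_n) (E : nat -> 'M[R]_(n, c))
    (X : 'M[R]_(c, e)) k :
  adj_sum B (fun j => E j *m X) k = adj_sum B E k *m X.
Proof.
elim: k => [|k /= ->]; first by rewrite mul0mx.
by rewrite mulmxDl mulmxA.
Qed.

Lemma adj_sum_const {n c} (B : 'M[R]_n) (E : 'M[R]_(n, c)) k :
  adj_sum B (fun=> E) k = (geo B k)^T *m E.
Proof.
elim: k => [|k /= ->]; first by rewrite geo0 trmx0 mul0mx.
rewrite geoSl.
have -> : B *m geo B k = geo B k *m B by have := geo_comm B k 1; rewrite expr1.
by rewrite linearD /= trmx1 trmx_mul mulmxDl mul1mx addrC mulmxA.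
Qed.

Lemma adj_sum_le {n c} (B : 'M[R]_n) (E : nat -> 'M[R]_(n, c)) k e :
  opnorm B <= 1 -> (forall j, (j < k)%N -> fnorm (E j) <= e) ->
  fnorm (adj_sum B E k) <= k%:R * e.
Proof.
move=> B1; elim: k => [|k IH] Ee /=; first by rewrite fnorm0 mul0r.
apply: le_trans (fnormD _ _) _; rewrite -natr1 mulrDl mul1r.
apply: lerD; last exact: Ee.
apply: le_trans (fnorm_opnorm_tr _ _) _; apply: le_trans (IH _).
  by rewrite ler_piMl ?fnorm_ge0.
by move=> j jk; apply: Ee; apply: ltnW.
Qed.

Lemma fnorm_power {n c} (B : 'M[R]_n) (X : 'M[R]_(n, c)) k :
  fnorm (B ^+ k *m X) <= opnorm B ^+ k * fnorm X.
Proof.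
elim: k => [|k IH]; first by rewrite !expr0 mul1mx mul1r.
rewrite exprS -mulmxE -mulmxA exprS -mulrA.
by apply: le_trans (fnorm_opnorm _ _) _; rewrite ler_wpM2l ?opnorm_ge0.
Qed.

Lemma fnorm_geo {n c} (B : 'M[R]_n) (X : 'M[R]_(n, c)) k :
  fnorm (geo B k *m X) <= (\sum_(j < k) opnorm B ^+ j) * fnorm X.
Proof.
rewrite /geo mulmx_suml mulr_suml.
apply: le_trans (fnorm_sum (fun j => B ^+ j *m X)) _.
by apply: ler_sum => j _; exact: fnorm_power.
Qed.

(** The difference is B^j (1 + ... + B^(k-j-1)), a sum of k - j powers of norm at most 1. *)
Lemma fnorm_geoB {n c} (B : 'M[R]_n) (X : 'M[R]_(n, c)) j k :
  (j <= k)%N -> opnorm B <= 1 ->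
  fnorm ((geo B k - geo B j) *m X) <= k%:R * fnorm X.
Proof.
move=> jk B1; rewrite -{1}(subnKC jk) geoD addrC addKr -mulmxA.
have B0 := opnorm_ge0 B.
apply: le_trans (fnorm_power _ _ _) _.
apply: le_trans (ler_piMl (fnorm_ge0 _) _) _; first exact: exprn_ile1.
apply: le_trans (fnorm_geo _ _ _) _; rewrite ler_wpM2r ?fnorm_ge0 //.
apply: le_trans (_ : (k - j)%:R <= _); last by rewrite ler_nat leq_subr.
have -> : (k - j)%:R = \sum_(i < k - j) (1 : R) by rewrite sumr_const card_ord.
by apply: ler_sum => i _; exact: exprn_ile1.
Qed.

End Sums.

(** * The error recursion as a linear map *)

Section Iteration.
Context {R : realType}.

(** The pair (us, ps) is fixed by the inner step at ss, so F and g cancel in the errors. The error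
    of u after j inner steps enters that of p through H^T H, whence the two adjoint sums. *)
Lemma iter_inner_step {nu ns ng} (B : 'M[R]_nu) (M : 'M[R]_(nu, ns))
    (H : 'M[R]_(ng, nu)) (F : 'cV[R]_nu) (g : 'cV[R]_ng) s ss u us p ps k :
  us = B *m us + M *m ss + F -> ps = B^T *m ps + H^T *m (H *m us - g) ->
  let up := iter k (inner_step B M H F g s) (u, p) in
  up.1 - us = B ^+ k *m (u - us) + geo B k *m (M *m (s - ss)) /\
  up.2 - ps = (B ^+ k)^T *m (p - ps) +
    adj_sum B (fun j => H^T *m H *m B ^+ j) k *m (u - us) +
    adj_sum B (fun j => H^T *m H *m geo B j) k *m (M *m (s - ss)).
Proof.
move=> usE psE; elim: k => [|k [IH1 IH2]] /=.
  by rewrite expr0 trmx1 !mul1mx geo0 !mul0mx !addr0.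
split.
  rewrite geoSl exprS -mulmxE mulmxDl mul1mx -!mulmxA addrCA -mulmxDr -IH1.
  rewrite [in LHS]usE opprD addrA [_ - F]addrC; set v := iter _ _ _.
  rewrite !mulmxBr opprD; move: (B *m v.1) (B *m us) (M *m s) (M *m ss).
  by move=> a b c e; apply/matrixP => i j; rewrite !mxE; ring.
have -> : (B ^+ k.+1)^T = B^T *m (B ^+ k)^T.
  by rewrite exprSr -mulmxE trmx_mul.
rewrite !mulmxDl -[RHS]addrA [X in _ = _ + X]addrACA [RHS]addrA.
set v := iter _ _ _ in IH1 IH2 *.
have -> : B^T *m (B ^+ k)^T *m (p - ps) +
    (B^T *m adj_sum B (fun j => H^T *m H *m B ^+ j) k *m (u - us) +
     B^T *m adj_sum B (fun j => H^T *m H *m geo B j) k *m (M *m (s - ss))) =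
    B^T *m (v.2 - ps).
  by rewrite IH2 !mulmxDr !mulmxA addrA.
have -> : H^T *m H *m B ^+ k *m (u - us) +
    H^T *m H *m geo B k *m (M *m (s - ss)) = H^T *m (H *m (v.1 - us)).
  by rewrite IH1 !mulmxDr !mulmxA.
rewrite [in LHS]psE !mulmxBr.
move: (B^T *m v.2) (B^T *m ps) (H^T *m (H *m v.1)).
move: (H^T *m (H *m us)) (H^T *m g).
by move=> a b c e f; apply/matrixP => i j; rewrite !mxE; ring.
Qed.

(** The right factor updates s, with c = 1 / (1 + tau alpha) solving the implicit descent equation;
    the left factor then feeds the new s into u and p. *)
Definition step_mx {nu ns} (D T G S : 'M[R]_nu) (M : 'M[R]_(nu, ns))
    (c tau : R) : 'M[R]_(ns + (nu + nu)) :=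
  block_mx 1%:M 0 (col_mx (T *m M) (S *m M)) (block_mx D 0 G D^T) *m
  block_mx c%:M (row_mx 0 (- (c * tau) *: M^T)) 0 1%:M.

Lemma step_mxE {nu ns e} (D T G S : 'M[R]_nu) (M : 'M[R]_(nu, ns)) (c tau : R)
    (s : 'M[R]_(ns, e)) (u p : 'M[R]_(nu, e)) :
  let s' := c *: (s - tau *: (M^T *m p)) in
  step_mx D T G S M c tau *m col_mx s (col_mx u p) =
  col_mx s' (col_mx (D *m u + T *m (M *m s'))
                    (D^T *m p + G *m u + S *m (M *m s'))).
Proof.
move=> s'; rewrite /step_mx -mulmxA mul_block_col mul_row_col mul0mx mul1mx.
rewrite add0r mul0mx add0r.
have -> : c%:M *m s + - (c * tau) *: M^T *m p = s'.
  by rewrite mul_scalar_mx -scalemxAl /s' scalerBr scalerA scaleNr.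
rewrite mul_block_col mul1mx mul0mx addr0 mul_block_col mul_col_mx.
rewrite mul0mx addr0 add_col_mx -!mulmxA; congr (col_mx _ (col_mx _ _)).
  by rewrite addrC.
by rewrite addrC [G *m u + _]addrC.
Qed.

End Iteration.

(** * The limit point: states, adjoint states and the regularised minimizer *)

Section Limit.
Context {R : realType}.

Lemma affine_fixpointP {n c} (B : 'M[R]_n) (f u : 'M[R]_(n, c)) :
  1%:M - B \in unitmx -> u = B *m u + f <-> u = invmx (1%:M - B) *m f.
Proof.
move=> Bu; split=> [uE|->].
  have -> : f = (1%:M - B) *m u.
    by rewrite mulmxBl mul1mx {1}uE addrC addKr.
  by rewrite mulKmx.
apply/eqP; rewrite [X in _ == X]addrC -subr_eq.
by rewrite -[X in X - _]mul1mx -mulmxBl mulKVmx.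
Qed.

Lemma stateE {nu ns} (B : 'M[R]_nu) (M : 'M[R]_(nu, ns)) (F : 'cV[R]_nu) s :
  1%:M - B \in unitmx -> state B M F s = invmx (1%:M - B) *m (M *m s + F).
Proof.
move=> Bu; apply/affine_fixpointP => //.
have /(xgetPex 0) : exists u, u = B *m u + M *m s + F.
  exists (invmx (1%:M - B) *m (M *m s + F)); rewrite -addrA.
  exact/affine_fixpointP.
by rewrite -/(state B M F s) /= -addrA.
Qed.

Lemma adjoint_stateE {nu ns ng} (B : 'M[R]_nu) (M : 'M[R]_(nu, ns))
    (H : 'M[R]_(ng, nu)) (F : 'cV[R]_nu) (g : 'cV[R]_ng) s :
  1%:M - B \in unitmx -> adjoint_state B M H F g s =
    (invmx (1%:M - B))^T *m (H^T *m (H *m state B M F s - g)).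
Proof.
move=> Bu.
have trB : 1%:M - B^T = (1%:M - B)^T by rewrite linearB /= trmx1.
have Btu : 1%:M - B^T \in unitmx by rewrite trB unitmx_tr.
rewrite trmx_inv -trB; apply/affine_fixpointP => //.
have /(xgetPex 0) // : exists p, p = B^T *m p + H^T *m (H *m state B M F s - g).
by exists (invmx (1%:M - B^T) *m (H^T *m (H *m state B M F s - g)));
  apply/affine_fixpointP.
Qed.

Lemma tikhonov_minimizer {m n} (A : 'M[R]_(m, n)) (r : 'cV[R]_m) (al : R)
    (J : 'cV[R]_n -> R) :
  0 <= al -> injective (fun s : 'cV[R]_n => A *m s) ->
  (forall s, J s = 1 / 2 * enorm (A *m s + r) ^+ 2 + al / 2 * enorm s ^+ 2) ->
  exists2 ss, unique (minimizer J) ss & A^T *m (A *m ss + r) + al *: ss = 0.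
Proof.
move=> al0 injA JE.
have A0 (s : 'cV[R]_n) : A *m s = 0 -> s = 0.
  by move=> h; apply: (injA s 0); rewrite /= h mulmx0.
pose Q := A^T *m A + al%:M.
(* Injectivity of A makes [Q] definite even when al = 0. *)
have Qu : Q \in unitmx.
  apply: unitmx_ker0 => s Qs; apply/A0/dotm_eq0.
  have : dotm (A *m s) (A *m s) + al * dotm s s = 0.
    rewrite dotm_mull -dotmZr -dotmDr mulmxA -mul_scalar_mx -mulmxDl Qs.
    by rewrite /dotm mulmx0 mxtrace0.
  move/eqP; rewrite paddr_eq0 ?dotm_ge0 ?mulr_ge0 ?dotm_ge0 //.
  by case/andP => /eqP.
pose ss := - (invmx Q *m (A^T *m r)).
have ssE : A^T *m (A *m ss + r) + al *: ss = 0.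
  have : Q *m ss = - (A^T *m r) by rewrite /ss mulmxN mulKVmx.
  by rewrite mulmxDl mul_scalar_mx mulmxDr mulmxA addrAC => ->; rewrite addNr.
(* The normal equation [ssE] removes the first-order term; the remaining quadratic form vanishes
   only at e = 0. *)
have JD e : J (ss + e) = J ss + (1 / 2 * dotm (A *m e) (A *m e) +
    al / 2 * dotm e e).
  rewrite !JE !enormE !sqr_fnorm.
  have -> : A *m (ss + e) + r = (A *m ss + r) + A *m e.
    by rewrite mulmxDr addrAC.
  have : dotm e (A^T *m (A *m ss + r) + al *: ss) = 0.
    by rewrite ssE /dotm mulmx0 mxtrace0.
  rewrite dotmDr dotmZr -dotm_mull; move: (A *m ss + r) => w.
  rewrite [dotm (w + _) _]dotmDl ![dotm _ (w + _)]dotmDr.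
  rewrite [dotm (ss + _) _]dotmDl ![dotm _ (ss + _)]dotmDr.
  rewrite (dotmC w) (dotmC ss e); lra.
have JB y : J y = J ss + (1 / 2 * dotm (A *m (y - ss)) (A *m (y - ss)) +
    al / 2 * dotm (y - ss) (y - ss)).
  by rewrite -JD addrC subrK.
exists ss => //; split=> [y|y ymin].
  by rewrite (JB y) lerDl addr_ge0 // mulr_ge0 ?dotm_ge0 ?divr_ge0.
have := ymin ss; rewrite (JB y) gerDl => h.
suff /A0/eqP : A *m (y - ss) = 0 by rewrite subr_eq0 => /eqP.
apply: dotm_eq0; apply/eqP; rewrite eq_le dotm_ge0 andbT.
have : 0 <= al / 2 * dotm (y - ss) (y - ss).
  by rewrite mulr_ge0 ?dotm_ge0 ?divr_ge0.
lra.
Qed.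

Lemma cvg_mx_entrywise {n} (f : nat -> 'cV[R]_n) (l : 'cV[R]_n) :
  (forall i, (f m - l) i 0 @[m --> \oo] --> (0 : R)) -> f m @[m --> \oo] --> l.
Proof.
move=> fl; apply/cvg_ballP => e e0.
have h : \sum_i `|(f m - l) i 0| @[m --> \oo] --> (0 : R).
  by apply: cvg0_sum => i; apply/norm_cvg0P.
have [N hN] := (cvg0P _).1 h e e0.
exists N => // m /= Nm; split=> // i j; rewrite ord1.
have := hN m Nm; rewrite ger0_norm ?sumr_ge0 // => /(le_lt_trans _); apply.
rewrite (bigD1 i) //= distrC !mxE lerDl sumr_ge0 // => k _.
Qed.

End Limit.

(** * Convergence from bounds on the matrices of the recursion *)

Section Convergence.
Context {R : realType}.

(** With T_j = [geo B j], this is the defect of using the intermediate T_j instead of the final T_k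
    in the adjoint sums: T_k^T H^T H T_k = S + U. *)
Definition coupling {nu ng} (B : 'M[R]_nu) (H : 'M[R]_(ng, nu)) k : 'M[R]_nu :=
  adj_sum B (fun j => H^T *m H *m (geo B k - geo B j)) k.

Lemma one_shot_converges_of_bounds {nu ns ng : nat} k
    (B : 'M[R]_nu) (M : 'M[R]_(nu, ns)) (H : 'M[R]_(ng, nu))
    (F : 'cV[R]_nu) (g : 'cV[R]_ng) (alpha tau K c d m r q : R) :
  0 <= alpha ->
  injective (fun s : 'cV[R]_ns => H *m invmx (1%:M - B) *m M *m s) ->
  (forall (X : 'M[R]_(nu, 2)) (x y : R), x ^+ 2 + y ^+ 2 <= 1 ->
     fnorm X <= K * fnorm (X - cxscale x y (B ^+ k *m X))) ->
  (forall X : 'M[R]_(nu, 2), fnorm (H *m (geo B k *m X)) <= c * fnorm X) ->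
  (forall X : 'M[R]_(nu, 2), fnorm (B ^+ k *m X) <= d * fnorm X) ->
  (forall X : 'M[R]_(ns, 2), fnorm (M *m X) <= m * fnorm X) ->
  (forall X : 'M[R]_(nu, 2), fnorm (coupling B H k *m X) <= r * fnorm X) ->
  0 <= K -> 0 <= c -> 0 <= d -> 0 <= m -> 0 <= r -> 0 <= q ->
  c * (K * m) <= q -> c * (d * (K ^+ 2 * m)) <= q ->
  r * (K * m) ^+ 2 <= q ^+ 2 ->
  0 < tau -> tau * q ^+ 2 <= 1 / 8 ->
  one_shot_converges k B M H F g alpha tau.
Proof.
move=> al0 inj hK hc hd hm hr K0 c0 d0 m0 r0 q0 q1 q2 q3 tau0 tauq.
(* A fixed vector of B is fixed by B^k, and the resolvent bound at z = 1 makes it 0. *)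
have Bu : 1%:M - B \in unitmx.
  apply: unitmx_ker0 => x /eqP; rewrite mulmxBl mul1mx subr_eq0 => /eqP xE.
  have DE : B ^+ k *m x = x.
    elim: (k) => [|j IH]; first by rewrite expr0 mul1mx.
    by rewrite exprSr -mulmxE -mulmxA -xE IH.
  have XE : B ^+ k *m row_mx x x = row_mx x x :> 'M[R]_(nu, 1 + 1).
    by rewrite mul_mx_row DE.
  have := hK (row_mx x x : 'M[R]_(nu, 1 + 1)) 1 0.
  rewrite XE /cxscale scale1r scale0r addr0 subrr fnorm0 mulr0.
  rewrite expr1n expr0n addr0 => /(_ (lexx _)) X0.
  have : row_mx x x = 0 :> 'M[R]_(nu, 1 + 1).
    by apply: fnorm0_eq0; apply/eqP; rewrite eq_le X0 fnorm_ge0.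
  by rewrite -[0]row_mx0 => /eq_row_mx[].
set V := invmx (1%:M - B) in inj.
pose A := H *m V *m M; pose r0' := H *m (V *m F) - g.
have [ss ssm ssE] : exists2 ss, unique (minimizer (cost B M H F g alpha)) ss &
    A^T *m (A *m ss + r0') + alpha *: ss = 0.
  apply: tikhonov_minimizer => // s.
  by rewrite /cost stateE // -/V mulmxDr mulmxDr /A /r0' !mulmxA addrA.
exists ss => // sigma u p run.
set us := state B M F ss; set ps := adjoint_state B M H F g ss.
have usE : us = B *m us + M *m ss + F.
  by rewrite -addrA; apply/affine_fixpointP => //; exact: stateE.
have HusE : H *m us - g = A *m ss + r0'.
  by rewrite /us stateE // -/V mulmxDr mulmxDr /A /r0' !mulmxA addrA.
have psV : ps = V^T *m (H^T *m (H *m us - g)) by exact: adjoint_stateE.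
have psE : ps = B^T *m ps + H^T *m (H *m us - g).
  have trB : 1%:M - B^T = (1%:M - B)^T by rewrite linearB /= trmx1.
  apply/affine_fixpointP; first by rewrite trB unitmx_tr.
  by rewrite trB -trmx_inv.
(* The optimality condition makes ss stationary for the descent equation. *)
have optE : M^T *m ps = - (alpha *: ss).
  apply/eqP; rewrite -addr_eq0 -ssE psV HusE /A !trmx_mul !mulmxA.
  by rewrite eqxx.
pose D := B ^+ k; pose T := geo B k; pose U := coupling B H k.
pose G := adj_sum B (fun j => H^T *m H *m B ^+ j) k.
pose S := adj_sum B (fun j => H^T *m H *m geo B j) k.
have DT : D *m T = T *m D by exact: geo_comm.
have SE : T^T *m H^T *m H *m T = S + U.
  rewrite /S /U /coupling -adj_sumD -!mulmxA -adj_sum_const.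
  apply: eq_adj_sum => j; rewrite -!mulmxA -!mulmxDr.
  by rewrite addrC subrK.
(* Termwise B^j T_k = T_j B^k + (T_k - T_j), from splitting T_(j+k) in the two possible ways. *)
have GE : G *m T = S *m D + U.
  rewrite /G /S /U /coupling -!adj_sumM -adj_sumD.
  apply: eq_adj_sum => j; rewrite -!mulmxA -!mulmxDr; congr (_ *m (_ *m _)).
  apply: (addrI (geo B j)); rewrite -geoD addnC geoD addrC geo_comm -/D -/T.
  by rewrite [RHS]addrC -addrA subrK.
pose gam := 1 + tau * alpha.
have gam1 : 1 <= gam by rewrite lerDl mulr_ge0 // ltW.
have gam0 : gam != 0 by rewrite gt_eqF // (lt_le_trans ltr01).
pose L := step_mx D T G S M gam^-1 tau.
pose w n := col_mx (sigma n - ss) (col_mx (u n - us) (p n - ps)).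
have wS n : w n.+1 = L *m w n.
  have [sE upE] := run n.
  have esE : sigma n.+1 - ss =
      gam^-1 *: (sigma n - ss - tau *: (M^T *m (p n - ps))).
    apply: (scalerI gam0); rewrite scalerA mulfV // scale1r.
    rewrite mulmxBr optE /gam scalerDl scale1r [X in X - ss + _]sE.
    move: (sigma n.+1) (sigma n) (M^T *m p n) => a b e.
    by apply/matrixP => i j; rewrite !mxE; ring.
  have [] := @iter_inner_step R nu ns ng B M H F g (sigma n.+1) ss (u n) us
    (p n) ps k usE psE.
  rewrite -upE /= => uE pE.
  by rewrite /w /L step_mxE -esE uE pE.
have wE n : w n = L ^+ n *m w 0%N.
  elim: n => [|n IH]; first by rewrite expr0 mul1mx.
  by rewrite wS IH exprS -mulmxE mulmxA.
have w0 i : w n i 0 @[n --> \oo] --> (0 : R).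
  have h : (L ^+ n *m w 0%N) i 0 @[n --> \oo] --> (0 : R).
    apply: cvg0_powers_cxscale => X lx ly l1.
    rewrite -[X]vsubmxK -[dsubmx X]vsubmxK.
    set s := usubmx X; set eu := usubmx _; set ep := dsubmx _.
    rewrite step_mxE /cxscale !mul_col_mx !scale_col_mx !add_col_mx.
    rewrite -!/(cxscale _ _ _) => /eq_col_mx[sE /eq_col_mx[uE pE]].
    rewrite sE in uE pE.
    have [s0 u0 p0] : [/\ s = 0, eu = 0 & ep = 0].
      apply: (@no_unstable_eigenvector R nu ns ng D T G U S M H K c d m r q
        tau gam lx ly s eu ep hK hc hd hm hr K0 c0 d0 m0 r0 q0 q1 q2 q3
        tau0 tauq gam1 l1 DT SE GE _ _ (esym uE) (esym pE)); last first.
        by rewrite -sE scalerA mulfV // scale1r.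
      (* As (1 - B) T_k = 1 - B^k, the vector T v equals (1 - B)^-1 M t, so H T v = 0 says A t =
         0. *)
      move=> t v vE Hv.
      have TvE : (1%:M - B) *m (T *m v) = M *m t.
        by rewrite mulmxA geo_telescope mulmxBl mul1mx.
      have {}TvE : T *m v = V *m (M *m t) by rewrite -TvE mulKmx.
      have At : A *m t = 0 by rewrite /A -!mulmxA -TvE.
      apply/matrixP => k' j; rewrite mxE.
      have : col j t = 0.
        by apply: (inj _ 0); rewrite /= mulmx0 colE mulmxA At mul0mx.
      by move/colP/(_ k'); rewrite !mxE.
    by rewrite s0 u0 p0 !col_mx0.
  by apply: cvg_trans h; apply: near_eq_cvg; near=> n; rewrite (wE n).
split; apply: cvg_mx_entrywise => i.
- have h := w0 (lshift _ i); apply: cvg_trans h; apply: near_eq_cvg.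
  by near=> n; rewrite /w col_mxEu.
- have h := w0 (rshift _ (lshift _ i)); apply: cvg_trans h; apply: near_eq_cvg.
  by near=> n; rewrite /w col_mxEd col_mxEu.
- have h := w0 (rshift _ (rshift _ i)); apply: cvg_trans h; apply: near_eq_cvg.
  by near=> n; rewrite /w !col_mxEd.
Unshelve. all: by end_near. Qed.

End Convergence.

(** * Explicit admissible step sizes *)

Section StepSizes.
Context {R : realType}.

Lemma one_shot_converges_small_step (k nu ns ng : nat) (B : 'M[R]_nu)
    (M : 'M[R]_(nu, ns)) (H : 'M[R]_(ng, nu)) (F : 'cV[R]_nu)
    (g : 'cV[R]_ng) (alpha : R) :
  (0 < k)%N -> one_shot_admissible B M H alpha ->
  exists2 tau0 : R, 0 < tau0 &
    forall tau : R, 0 < tau < tau0 ->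
      one_shot_converges k B M H F g alpha tau.
Proof.
move=> k0 [al0 B1 inj]; have [K K0 hK] := resolvent_bound _ _ _ k0 B1.
pose c := opnorm (H *m geo B k); pose d := opnorm (B ^+ k).
pose m := opnorm M; pose r := opnorm (coupling B H k).
have c0 : 0 <= c by exact: opnorm_ge0.
have d0 : 0 <= d by exact: opnorm_ge0.
have m0 : 0 <= m by exact: opnorm_ge0.
have r0 : 0 <= r by exact: opnorm_ge0.
pose x1 := c * (K * m); pose x2 := c * (d * (K ^+ 2 * m)).
pose x3 := r * (K * m) ^+ 2.
have x10 : 0 <= x1 by rewrite !mulr_ge0.
have x20 : 0 <= x2 by rewrite !mulr_ge0 // sqr_ge0.
have x30 : 0 <= x3 by rewrite !mulr_ge0 // sqr_ge0.
(* The added 1 makes q >= 1, so that x3 <= q <= q^2. *)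
pose q := x1 + x2 + x3 + 1.
have q1 : 1 <= q by rewrite lerDr !addr_ge0.
have q0 : 0 <= q by exact: le_trans q1.
exists (8 * q ^+ 2)^-1.
  by rewrite invr_gt0 mulr_gt0 // exprn_gt0 // (lt_le_trans ltr01).
move=> tau /andP[tau0 tau1].
apply: (@one_shot_converges_of_bounds _ _ _ _ k B M H F g alpha tau K c d m r q)
  => //.
- by move=> X; rewrite mulmxA; exact: fnorm_opnorm.
- by move=> X; exact: fnorm_opnorm.
- by move=> X; exact: fnorm_opnorm.
- by move=> X; exact: fnorm_opnorm.
- by rewrite -/x1 /q -!addrA lerDl !addr_ge0.
- by rewrite -/x2 /q (addrC x1) -!addrA lerDl !addr_ge0.
- apply: (@le_trans _ _ q); last by rewrite expr2 ler_peMr.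
  by rewrite -/x3 /q addrAC lerDr !addr_ge0.
- rewrite -ler_pdivlMr ?exprn_gt0 ?(lt_le_trans ltr01) //.
  by rewrite mul1r -invfM ltW.
Qed.

Lemma one_shot_converges_contraction (k nu ns ng : nat) (B : 'M[R]_nu)
    (M : 'M[R]_(nu, ns)) (H : 'M[R]_(ng, nu)) (F : 'cV[R]_nu)
    (g : 'cV[R]_ng) (alpha tau : R) :
  (0 < k)%N -> one_shot_admissible B M H alpha -> opnorm B < 1 -> 0 < tau ->
  opnorm H ^+ 2 * opnorm M ^+ 2
     / ((1 - opnorm B) ^+ 2 * (1 - opnorm B ^+ k) ^+ 2)
     * (8 * k%:R ^+ 2) * tau <= 1 ->
  one_shot_converges k B M H F g alpha tau.
Proof.
move=> k0 [al0 _ inj] B1 tau0.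
set b := opnorm B; set h := opnorm H; set m := opnorm M => tauq.
have b0 : 0 <= b by exact: opnorm_ge0.
have h0 : 0 <= h by exact: opnorm_ge0.
have m0 : 0 <= m by exact: opnorm_ge0.
have bk1 : b ^+ k < 1 by rewrite exprn_ilt1 // -lt0n.
have bk0 : 0 <= b ^+ k by rewrite exprn_ge0.
have e0 : 0 < 1 - b by rewrite subr_gt0.
have ek0 : 0 < 1 - b ^+ k by rewrite subr_gt0.
have en : 1 - b != 0 by rewrite gt_eqF.
have ekn : 1 - b ^+ k != 0 by rewrite gt_eqF.
have kR : 1 <= k%:R :> R by rewrite ler1n.
have geoE : \sum_(j < k) b ^+ j = (1 - b ^+ k) / (1 - b).
  have := subrX1 b k => bE; apply: (mulIf en); rewrite divfK //.
  rewrite mulrC; lra.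
have hm0 : 0 <= h * m / (1 - b) by rewrite divr_ge0 ?mulr_ge0 // ltW.
have eki : 1 <= (1 - b ^+ k)^-1 by rewrite invf_ge1 // lerBlDr lerDl.
have ei : 1 <= (1 - b)^-1 by rewrite invf_ge1 // lerBlDr lerDl.
pose y := h * m / (1 - b) / (1 - b ^+ k); pose q := k%:R * y.
have y0 : 0 <= y by rewrite divr_ge0 // ltW.
have yq : y <= q by rewrite /q ler_peMl.
(* The resolvent is bounded by a Neumann series, H T_k by a geometric sum, B^k by 1, and [coupling]
   by k terms of size at most h^2 k. *)
apply: (@one_shot_converges_of_bounds _ _ _ _ k B M H F g alpha tau
  (1 - b ^+ k)^-1 (h * ((1 - b ^+ k) / (1 - b))) 1 m (k%:R * (h ^+ 2 * k%:R)) q)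
  => //.
- apply: resolvent_bound_contraction => // X; exact: fnorm_power.
- move=> X; apply: le_trans (fnorm_opnorm _ _) _; rewrite -mulrA ler_wpM2l //.
  by rewrite -geoE; exact: fnorm_geo.
- move=> X; apply: le_trans (fnorm_power _ _ _) _.
  by rewrite ler_wpM2r ?fnorm_ge0 // ltW.
- by move=> X; exact: fnorm_opnorm.
- move=> X; rewrite /coupling -adj_sumM -mulrA.
  apply: adj_sum_le => [|j jk]; first exact: ltW.
  rewrite -!mulmxA; apply: le_trans (fnorm_opnorm_tr _ _) _.
  rewrite expr2 -!mulrA ler_wpM2l //.
  apply: le_trans (fnorm_opnorm _ _) _; rewrite ler_wpM2l //.
  by apply: fnorm_geoB; [exact: ltnW | exact: ltW].
- by rewrite invr_ge0 ltW.
- by rewrite mulr_ge0 // divr_ge0 // ltW.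
- by rewrite !mulr_ge0 // sqr_ge0.
- by rewrite mulr_ge0.
- apply: le_trans yq; rewrite /y.
  have -> : h * ((1 - b ^+ k) / (1 - b)) * ((1 - b ^+ k)^-1 * m) =
    h * m / (1 - b) by field; rewrite en ekn.
  by rewrite ler_peMr.
- apply: le_trans yq; rewrite /y le_eqVlt; apply/orP; left; apply/eqP.
  by field; rewrite en ekn.
- have -> : q ^+ 2 = k%:R * (h ^+ 2 * k%:R) * ((1 - b ^+ k)^-1 * m) ^+ 2 *
    ((1 - b)^-1) ^+ 2 by rewrite /q /y; field; rewrite en ekn.
  rewrite ler_peMr ?exprn_ege1 // mulr_ge0 ?sqr_ge0 // mulr_ge0 //.
  by rewrite mulr_ge0 ?sqr_ge0.
- move: tauq.
  have -> : h ^+ 2 * m ^+ 2 / ((1 - b) ^+ 2 * (1 - b ^+ k) ^+ 2) *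
    (8 * k%:R ^+ 2) * tau = 8 * (tau * q ^+ 2).
    by rewrite /q /y; field; rewrite en ekn.
  lra.
Qed.

Lemma piecewise_poly_const d (c : R) : piecewise_poly d (fun=> c).
Proof.
exists 1%N, (fun=> `[0, 1[); split.
- by move=> i j _ _ _; rewrite (ord1 i) (ord1 j).
- by apply/seteqP; split=> x /= => [[]//|x01]; exists ord0.
- move=> _; exists (1 / 2); rewrite interior_itv /= in_itv /=.
  by apply/andP; split; lra.
- move=> _; exists c%:P; last by move=> x _; rewrite hornerC.
  by apply: leq_trans (size_polyC_leq1 _) _.
Qed.

End StepSizes.

Theorem theorem4p11 (R : realType) :
  (forall (k nu ns ng : nat) (B : 'M[R]_nu) (M : 'M[R]_(nu, ns))
     (H : 'M[R]_(ng, nu)) (F : 'cV[R]_nu) (g : 'cV[R]_ng) (alpha : R),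
     (0 < k)%N -> one_shot_admissible B M H alpha ->
     exists2 tau0 : R, 0 < tau0 &
       forall tau : R, 0 < tau < tau0 ->
         one_shot_converges k B M H F g alpha tau)
  /\
  (exists (C : R) (P : nat -> R -> R),
     [/\ 0 < C,
         forall k : nat, (0 < k)%N ->
           piecewise_poly (4 * k) (P k) /\
           (forall x : R, 0 <= x < 1 -> 0 < P k x) &
         forall (k nu ns ng : nat) (B : 'M[R]_nu) (M : 'M[R]_(nu, ns))
           (H : 'M[R]_(ng, nu)) (F : 'cV[R]_nu) (g : 'cV[R]_ng) (alpha : R),
           (0 < k)%N -> one_shot_admissible B M H alpha ->
           opnorm B < 1 ->
           forall tau : R, 0 < tau ->
             (opnorm H ^+ 2 * opnorm M ^+ 2
                / ((1 - opnorm B) ^+ 2 * (1 - opnorm B ^+ k) ^+ 2)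
                * P k (opnorm B) + C * alpha) * tau < 1 ->
             one_shot_converges k B M H F g alpha tau]).
Proof.
split; first by move=> *; exact: one_shot_converges_small_step.
(* The factor 8 k^2 restates tau q^2 <= 1 / 8 for q = k |H| |M| / ((1 - |B|) (1 - |B|^k)). *)
exists 1, (fun k _ => 8 * k%:R ^+ 2); split=> // [k k0|].
  split=> [|x _]; first exact: piecewise_poly_const.
  by rewrite mulr_gt0 // exprn_gt0 // ltr0n.
move=> k nu ns ng B M H F g alpha k0 adm B1 tau tau0 tau1.
apply: one_shot_converges_contraction => //; apply: le_trans (ltW tau1).
have [al0 _ _] := adm.
by apply: ler_wpM2r; [exact: ltW | rewrite lerDl mul1r].
Qed.
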